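(* Consider a network instance $G(\mathcal{V},\mathcal{E})$, $\{c_e\}$, $\{u_e\}$, $\{r_i\}$, $\{\phi_i\}$, $w>0$ with non-empty set of feasible flows, and let $m_{i\to e}^t$ be the messages of the min-sum algorithm for this instance (all defined in the context). Then for each $i\in\mathcal{V}_{\text{s}}$, each $e\in\mathcal{E}_i$ and each $t\geq 1$, the message $m_{i\to e}^t$ is a piecewise-linear convex function with breakpoints in $\{0,1,\ldots,u_e\}$. Moreover, the complexity of its update, i.e., of computing $m_{i\to e}^t$ from the messages of iteration $t-1$ by the formula $$m_{i\to e}^t(z) = g_e(z) + \min_{\mathbf{\tilde{z}}\in\mathbb{R}_+^{|\mathcal{E}_i|}:\, \tilde{z}_e=z} \left\{f_i(\mathbf{\tilde{z}}) + \sum_{e'\in\mathcal{E}_i\setminus e} m_{k\to e'}^{t-1}(\tilde{z}_{e'})\right\},\qquad z\in\mathbb{R}_+,$$ where for each $e'\in\mathcal{E}_i\setminus e$ the node $k$ is the other endpoint of $e'$ (that is, $e'=(i,k)$ or $e'=(k,i)$), is linear in the total capacity of the input and output edges of node $i$ and logarithmic in $|\mathcal{E}_i^{\text{in}}|$ and $|\mathcal{E}_i^{\text{out}}|$.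
   Context: Network. $G(\mathcal{V},\mathcal{E})$ is a finite directed graph with $\mathcal{V}=\mathcal{V}_{\text{s}}\cup\mathcal{V}_{\text{d}}$, where $\mathcal{V}_{\text{s}}=\{1,\ldots,n\}$ (source/relay nodes) and $\mathcal{V}_{\text{d}}=\{n+1,\ldots,n+m\}$ (destination nodes); an edge $(i,j)\in\mathcal{E}$ means that node $i$ can transmit directly to node $j$, with $i\neq j$. For $i\in\mathcal{V}$, $\mathcal{E}_i$, $\mathcal{E}_i^{\text{out}}$, $\mathcal{E}_i^{\text{in}}$ denote the sets of all edges incident to $i$, outgoing from $i$, and incoming to $i$, respectively. Each $i\in\mathcal{V}_{\text{s}}$ has a rate $r_i\in\mathbb{N}$ (possibly $0$); each edge $e$ has a capacity $u_e\in\mathbb{N}_{>0}$ and a cost $c_e>0$. The total capacity of the input and output edges of node $i$ is $\sum_{e'\in\mathcal{E}_i}u_{e'}$. Feasible flows. A flow $\{x_e\}_{e\in\mathcal{E}}$ is feasible if $\sum_{e\in\mathcal{E}_i^{\text{out}}} x_e - \sum_{e\in\mathcal{E}_i^{\text{in}}} x_e = r_i$ for all $i\in\mathcal{V}_{\text{s}}$ and $0\leq x_e\leq u_e$ for all $e\in\mathcal{E}$. The set of feasible flows is assumed non-empty. Load penalties. For each $i\in\mathcal{V}_{\text{s}}$, $\phi_i:[0,\infty)\to\mathbb{R}$ is a strictly increasing, piecewise-linear convex function whose breakpoints are integers; $w>0$ is a real parameter. The optimization problem being solved is to minimize $(1-w) \sum_{e\in\mathcal{E}} c_e x_e + w\sum_{i\in\mathcal{V}_{\text{s}}}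 \phi_i\big(\sum_{e\in\mathcal{E}_i^{\text{out}}} x_e\big)$ over feasible flows. Local functions. For $i\in\mathcal{V}_{\text{s}}$ and $\mathbf{z}\in\mathbb{R}_+^{|\mathcal{E}_i|}$, $\psi_i(\mathbf{z})=0$ if $\sum_{e\in\mathcal{E}_i^{\text{out}}} z_e - \sum_{e\in\mathcal{E}_i^{\text{in}}} z_e = r_i$ and $\psi_i(\mathbf{z})=\infty$ otherwise; $f_i(\mathbf{z}) = \psi_i(\mathbf{z}) + w\,\phi_i\big(\sum_{e\in\mathcal{E}_i^{\text{out}}} z_e\big)$. For $i\in\mathcal{V}_{\text{d}}$, $f_i\equiv 0$. For $e\in\mathcal{E}$, $g_e:\mathbb{R}\to\mathbb{R}\cup\{\infty\}$ is $g_e(z)=(1-w)c_e z$ if $0\leq z\leq u_e$, and $g_e(z)=\infty$ otherwise. Messages. Initialize $m_{i\to e}^0(z)=g_e(z)$ for all $i\in\mathcal{V}$, $e\in\mathcal{E}_i$, $z\in\mathbb{R}_+$. For $t\geq 1$ and $i\in\mathcal{V}_{\text{s}}$, $e\in\mathcal{E}_i$, $m_{i\to e}^t$ is given by the update formula in the claim. For $i\in\mathcal{V}_{\text{d}}$ the messages are not updated: $m_{i\to e}^t=g_e$ for all $t$. Convention. Messages take values in $\mathbb{R}\cup\{\infty\}$; such a function is piecewise-linear convex if it is convex and is linear on each of finitely many intervals partitioning the set where it is finite. Its breakpoints are the endpoints of these intervals (including the endpoints of the set where it is finite). Piecewise-linear convex functions are represented by their breakpoints and linear pieces, and complexity counts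 elementary operations. *)

(* Defs.v *)
From HB Require Import structures.
From mathcomp Require Import all_boot all_order all_algebra.
From mathcomp Require Import boolp classical_sets functions reals ereal.

Set Implicit Arguments.
Unset Strict Implicit.
Unset Printing Implicit Defensive.

Import Order.TTheory GRing.Theory Num.Theory.

Local Open Scope classical_set_scope.
Local Open Scope ring_scope.

(** * Piecewise-linear convex functions with values in R u {oo} *)

(* If f never takes the value -oo, then the right-hand side is the usual one
   (with 0 * oo = 0); pl_convex below excludes the value -oo. *)
Definition convex_efun (R : realType) (f : R -> \bar R) : Prop :=
  forall (x y s : R), 0 <= s <= 1 ->
    (f (s * x + (1 - s) * y)%R <= s%:E * f x + (1 - s)%:E * f y)%E.

Definition affine_on (R : realType) (f : R -> \bar R) (J : interval R) : Prop :=
  exists a b : R, forall z, z \in J -> f z = (a * z + b)%:E.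

Definition endpoint_in (R : realType) (B : set R) (b : itv_bound R) : Prop :=
  if b is BSide _ x then B x else True.

(* The intervals in s partition the set where f is finite: a point with
   f z < +oo lies in exactly one of them, any other point in none. (As f is
   affine, hence finite, on each interval, f z = -oo is impossible.) *)
Definition pl_convex (R : realType) (f : R -> \bar R) (B : set R) : Prop :=
  convex_efun f /\
  exists s : seq (interval R),
    [/\ forall z, count (fun J : interval R => z \in J) s = (f z < +oo)%E :> nat,
        forall J, J \in s -> affine_on f J
      & forall J, J \in s -> endpoint_in B J.1 /\ endpoint_in B J.2].

(* A function on [0, oo), extended by +oo to the negative reals. *)
Definition extend_nneg (R : realType) (h : R -> R) (z : R) : \bar R :=
  if 0 <= z then (h z)%:E else +oo%E.

Definition is_min (R : realType) (A : set (\bar R)) (y : \bar R) : Prop :=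
  A y /\ lbound A y.

(** * Network instances *)

(* The nodes are the disjoint union of the sources 'I_nsrc (inl) and the
   destinations 'I_ndst (inr). Capacities and costs are only meaningful on
   edges, and load i only on the nonnegative reals. *)
Record network (R : realType) := Network {
  nsrc : nat;
  ndst : nat;
  edges : {set ('I_nsrc + 'I_ndst) * ('I_nsrc + 'I_ndst)};
  edges_irrefl : forall e, e \in edges -> e.1 != e.2;
  rate : 'I_nsrc -> nat;
  cap : ('I_nsrc + 'I_ndst) * ('I_nsrc + 'I_ndst) -> nat;
  cap_gt0 : forall e, e \in edges -> (0 < cap e)%N;
  cost : ('I_nsrc + 'I_ndst) * ('I_nsrc + 'I_ndst) -> R;
  cost_gt0 : forall e, e \in edges -> 0 < cost e;
  load : 'I_nsrc -> R -> R;
  load_incr : forall i x y, 0 <= x -> x < y -> load i x < load i y;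
  load_plc : forall i,
    pl_convex (extend_nneg (load i)) [set x | x \is a Num.int];
  weight : R;
  weight_gt0 : 0 < weight }.

Definition node (R : realType) (N : network R) : finType :=
  ('I_(nsrc N) + 'I_(ndst N))%type.

Definition edge (R : realType) (N : network R) : finType :=
  (node N * node N)%type.

Definition out_edges (R : realType) (N : network R) (i : node N) : {set edge N} :=
  [set e in edges N | e.1 == i]%SET.

Definition in_edges (R : realType) (N : network R) (i : node N) : {set edge N} :=
  [set e in edges N | e.2 == i]%SET.

Definition inc_edges (R : realType) (N : network R) (i : node N) : {set edge N} :=
  (out_edges i :|: in_edges i)%SET.

Definition total_cap (R : realType) (N : network R) (i : node N) : nat :=
  (\sum_(e in inc_edges i) cap e)%N.

Definition excess (R : realType) (N : network R) (i : node N) (x : edge N -> R) : R :=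
  \sum_(e in out_edges i) x e - \sum_(e in in_edges i) x e.

Definition feasible_flow (R : realType) (N : network R) (x : edge N -> R) : Prop :=
  (forall i, excess (inl i : node N) x = (rate i)%:R) /\
  (forall e, e \in edges N -> 0 <= x e <= (cap e)%:R).

Definition other_end (R : realType) (N : network R) (i : node N) (e : edge N) : node N :=
  if e.1 == i then e.2 else e.1.

(** * Min-sum messages *)

Definition edge_fun (R : realType) (N : network R) (e : edge N) (z : R) : \bar R :=
  if 0 <= z <= (cap e)%:R then ((1 - weight N) * cost e * z)%:E else +oo%E.

Definition node_fun (R : realType) (N : network R) (i : 'I_(nsrc N))
    (z : edge N -> R) : \bar R :=
  ((if excess (inl i : node N) z == (rate i)%:R then 0%:E else +oo) +
   (weight N * load i (\sum_(e in out_edges (inl i : node N)) z e))%:E)%E.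

(* The values over which the update at source i towards edge e minimizes, when
   M e' is the message on e' from its other endpoint. Vectors indexed by the
   edges at i are represented by functions on all edges, whose values away from
   i are irrelevant. *)
Definition update_values (R : realType) (N : network R) (i : 'I_(nsrc N))
    (M : edge N -> R -> \bar R) (e : edge N) (z : R) : set (\bar R) :=
  [set (node_fun i zt +
        \sum_(e' in inc_edges (inl i : node N) :\ e) M e' (zt e'))%E
    | zt in [set zt : edge N -> R |
        (forall e', e' \in inc_edges (inl i : node N) -> 0 <= zt e') /\
        zt e = z]].

Fixpoint message (R : realType) (N : network R) (t : nat) (i : node N) (e : edge N)
    : R -> \bar R :=
  match t, i with
  | t'.+1, inl j => fun z =>
      (edge_fun e z +
       ereal_inf (update_values j
         (fun e' => message t' (other_end (inl j) e') e') e z))%E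
  | _, _ => edge_fun e
  end.

(** * Representation by breakpoints and linear pieces *)

(* ((l, h), (a, b)) is the linear piece z |-> a z + b on [l, h]; h may be +oo. *)
Definition piece (R : realType) : Type := ((R * \bar R) * (R * R))%type.

Definition lo (R : realType) (p : piece R) : R := p.1.1.
Definition hi (R : realType) (p : piece R) : \bar R := p.1.2.
Definition slope (R : realType) (p : piece R) : R := p.2.1.
Definition icpt (R : realType) (p : piece R) : R := p.2.2.

Definition in_piece (R : realType) (p : piece R) (z : R) : bool :=
  (lo p <= z) && (z%:E <= hi p)%E.

(* Consecutive pieces share an endpoint, and none is a single point unless it
   is the only one (then the function is finite at just one point). *)
Definition well_formed (R : realType) (s : seq (piece R)) : Prop :=
  sorted (fun p q : piece R => hi p == (lo q)%:E) s /\
  (all (fun p : piece R => ((lo p)%:E < hi p)%E) s \/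
   exists2 p, s = [:: p] & hi p = (lo p)%:E).

Definition represents (R : realType) (s : seq (piece R)) (B : set R)
    (f : R -> \bar R) : Prop :=
  [/\ well_formed s,
      forall p, p \in s -> B (lo p) /\ (forall r, hi p = r%:E -> B r),
      forall p z, p \in s -> in_piece p z -> f z = (slope p * z + icpt p)%:E
    & forall z, ~~ has (fun p => in_piece p z) s -> f z = +oo%E].

(** * Model of computation *)

(* Programs are finite collections of mutually recursive first-order functions
   over lists and pairs of real numbers. A program contains no instance data
   (its only numeric constants are 0 and 1), and every elementary operation has
   unit cost: variable access, allocation or inspection of a pair, real
   arithmetic, comparison of two reals, function call. *)

Inductive value (R : realType) : Type :=
  | VNum of R
  | VNil
  | VPair of value R & value R.
Arguments VNil {R}.

Inductive arith_op := Add | Sub | Mul | Div.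

(* Variables are de Bruijn indices. The body of a function has its single
   argument as variable 0; in Case v e0 e1, the branch e1 binds the first and
   second components of the pair as variables 0 and 1. *)
Inductive expr : Type :=
  | Var of nat
  | Zero
  | One
  | Arith of arith_op & expr & expr
  | MkNil
  | MkPair of expr & expr
  | Let of expr & expr
  | IfLe of expr & expr & expr & expr
  | Case of expr & expr & expr
  | Call of nat & expr.

Definition program := seq expr.

Definition arith (R : realType) (o : arith_op) (x y : R) : option R :=
  match o with
  | Add => Some (x + y)
  | Sub => Some (x - y)
  | Mul => Some (x * y)
  | Div => if y == 0 then None else Some (x / y)
  end.

(* evaluates P env a v k: in environment env, the expression a evaluates to v with
   k elementary operations. *)
Inductive evaluates (R : realType) (P : program) :
    seq (value R) -> expr -> value R -> nat -> Prop :=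
  | EvalVar env j v : onth env j = Some v -> evaluates P env (Var j) v 1
  | EvalZero env : evaluates P env Zero (VNum 0) 1
  | EvalOne env : evaluates P env One (VNum 1) 1
  | EvalArith env o a1 a2 x1 x2 y k1 k2 :
      evaluates P env a1 (VNum x1) k1 -> evaluates P env a2 (VNum x2) k2 ->
      arith o x1 x2 = Some y ->
      evaluates P env (Arith o a1 a2) (VNum y) (k1 + k2).+1
  | EvalMkNil env : evaluates P env MkNil VNil 1
  | EvalMkPair env a1 a2 v1 v2 k1 k2 :
      evaluates P env a1 v1 k1 -> evaluates P env a2 v2 k2 ->
      evaluates P env (MkPair a1 a2) (VPair v1 v2) (k1 + k2).+1
  | EvalLet env a1 a2 v1 v2 k1 k2 :
      evaluates P env a1 v1 k1 -> evaluates P (v1 :: env) a2 v2 k2 ->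
      evaluates P env (Let a1 a2) v2 (k1 + k2).+1
  | EvalIfLe env a1 a2 a3 a4 x1 x2 v k1 k2 k :
      evaluates P env a1 (VNum x1) k1 -> evaluates P env a2 (VNum x2) k2 ->
      evaluates P env (if x1 <= x2 then a3 else a4) v k ->
      evaluates P env (IfLe a1 a2 a3 a4) v (k1 + k2 + k).+1
  | EvalCaseNil env a a0 a1 v k1 k :
      evaluates P env a VNil k1 -> evaluates P env a0 v k ->
      evaluates P env (Case a a0 a1) v (k1 + k).+1
  | EvalCasePair env a a0 a1 v1 v2 v k1 k :
      evaluates P env a (VPair v1 v2) k1 -> evaluates P (v1 :: v2 :: env) a1 v k ->
      evaluates P env (Case a a0 a1) v (k1 + k).+1
  | EvalCall env f a body v1 v k1 k :
      evaluates P env a v1 k1 -> onth P f = Some body -> evaluates P [:: v1] body v k ->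
      evaluates P env (Call f a) v (k1 + k).+1.

(* Running P on an input means applying its function number 0 to it. *)
Definition computes (R : realType) (P : program) (input output : value R)
    (k : nat) : Prop :=
  evaluates P [:: input] (Call 0 (Var 0)) output k.

Definition enc_seq (R : realType) (T : Type) (enc : T -> value R) (s : seq T) : value R :=
  foldr (fun x v => VPair (enc x) v) VNil s.

Definition enc_ereal (R : realType) (x : \bar R) : value R :=
  if x is EFin r then VPair (VNum r) VNil else VNil.

Definition enc_piece (R : realType) (p : piece R) : value R :=
  VPair (VPair (VNum (lo p)) (enc_ereal (hi p))) (VPair (VNum (slope p)) (VNum (icpt p))).

Definition enc_pl (R : realType) (s : seq (piece R)) : value R :=
  enc_seq (@enc_piece R) s.

(* The local data at source i needed for the update towards e: the weight, the
   rate of i, the cost and capacity of e, whether e leaves i (1) or enters i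
   (0), a representation of the load penalty, and representations of the
   incoming messages on the other incoming and outgoing edges of i. *)
Definition update_input (R : realType) (N : network R) (i : 'I_(nsrc N)) (e : edge N)
    (sload : seq (piece R)) (smsg : edge N -> seq (piece R)) : value R :=
  enc_seq id
    [:: VNum (weight N); VNum (rate i)%:R; VNum (cost e); VNum (cap e)%:R;
        VNum (e \in out_edges (inl i : node N))%:R;
        enc_pl sload;
        enc_seq (@enc_pl R) [seq smsg e' | e' <- enum (in_edges (inl i : node N) :\ e)];
        enc_seq (@enc_pl R) [seq smsg e' | e' <- enum (out_edges (inl i : node N) :\ e)]].

Definition nat_upto (R : realType) (k : nat) : set R :=
  [set x | exists2 j : nat, (j <= k)%N & x = j%:R].

(* Main.v *)
(* All breakpoints being integers, a message is encoded by its left endpoint, its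
   value there and the nondecreasing list of its slopes on the unit intervals of
   its domain. The inf-convolution of two such functions adds endpoints and values
   and merges the slope lists, reflection z -> -z reverses and negates them, and
   adding the load penalty on the same unit grid adds slopes termwise. For an edge
   e at i, let A and B be the other edges at i on the opposite side of i from e and
   on the same side. The update minimizes, over the totals p and q of the flow on A
   and B subject to z = p + a - q - b (where {a, b} = {r_i, 0}), the penalty at
   p + a plus the inf-convolutions of the messages on A and on B: it is the
   inf-convolution of a penalized function of p with a reflected function of q. The
   lists are merged pairwise in rounds, so each of the logarithmically many rounds
   costs a constant times the total capacity. *)
Require Import Defs.
From HB Require Import structures.
From mathcomp Require Import all_boot all_order all_algebra.
From mathcomp Require Import boolp classical_sets functions reals ereal.
From mathcomp Require Import ring lra zify.

Import Order.TTheory GRing.Theory Num.Theory.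

Local Open Scope classical_set_scope.
Local Open Scope ring_scope.

(** * Partial sums of unit slopes *)

(** Sortedness of the slopes is convexity, and merging needs it only for one half of the claim: the
    merge exhibits a split that attains its value, and taking the smallest slopes first bounds every
    other split from below. Hence the minimum of an update is attained, on the same integer grid.
    The sign constraint on the vectors holds automatically, since messages are finite only on
    nonnegative arguments. Three obstacles shape the rest. The result of a convolution may start
    below 0 or end above the capacity; since all ends are integers, clipping never cuts a unit
    interval. Reading an encoding off a message requires a first piece, so no message may be
    infinite everywhere: this follows from a feasible flow, along which all messages stay finite.
    Finally, a load penalty may have arbitrarily many pieces, whereas the running time may depend
    only on capacities: the penalty is read lazily, up to a point that is linear in the total
    capacity because feasibility also bounds the rate. *)

Fixpoint slope_sum (R : realType) (S : seq R) (y : R) : R :=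
  if S is s :: S' then if y <= 1 then s * y else s + slope_sum R S' (y - 1) else 0.
Arguments slope_sum {R}.

Section SlopeSum.
Context {R : realType}.
Implicit Types (S T : seq R) (a b d s x y v : R).

Lemma merge_cons s S t T : merge <=%R (s :: S) (t :: T) =
  if s <= t then s :: merge <=%R S (t :: T) else t :: merge <=%R (s :: S) T.
Proof. by []. Qed.

Lemma itv0_eq0 y : 0 <= y <= 0%:R -> y = 0.
Proof. by rewrite -eq_le => /eqP. Qed.

Lemma slope_sum0 S : slope_sum S 0 = 0.
Proof. by case: S => //= s S; rewrite ler01 mulr0. Qed.

Lemma slope_sum_le1 s S y : y <= 1 -> slope_sum (s :: S) y = s * y.
Proof. by move=> /= ->. Qed.

Lemma slope_sum_ge1 s S y : 1 <= y -> slope_sum (s :: S) y = s + slope_sum S (y - 1).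
Proof.
rewrite /=; case: ifP => // y1 y1'; have -> : y = 1 by lra.
by rewrite subrr slope_sum0; ring.
Qed.

Lemma slope_sum_lb s T y : all (>= s) T -> 0 <= y <= (size T)%:R ->
  s * y <= slope_sum T y.
Proof.
elim: T y => [|t T IH] y; first by move=> _ /itv0_eq0 ->; rewrite mulr0.
move=> /= /andP[st /IH {}IH] /andP[y0]; rewrite -natr1 => yT.
case: ifPn => [y1|]; first by rewrite ler_wpM2r.
rewrite -ltNge => y1; have := IH (y - 1) ltac:(lra); nra.
Qed.

(** Over the last stretch of length [d] the slope is at least [s]. This is the exchange argument of
    merging: length [d] at the end of [T] can be traded for slope [s] without raising the sum. *)
Lemma slope_sum_incr s T y d : all (>= s) T -> 0 <= d <= y -> y <= (size T)%:R ->
  slope_sum T (y - d) + s * d <= slope_sum T y.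
Proof.
elim: T y => [|t T IH] y.
  by move=> _ /andP[d0 dy] y0; rewrite (itv0_eq0 d) ?mulr0 //= ?addr0 // d0 (le_trans dy).
move=> /= /andP[st sT] /andP[d0 dy]; rewrite -natr1 => yT.
have [y1|y1] := leP y 1.
  have -> : y - d <= 1 by lra.
  nra.
have [yd|yd] := leP (y - d) 1.
  have [e0|] := leP (y - 1) 0; first by lra.
  have := slope_sum_lb s T (y - 1) sT ltac:(lra).
  nra.
have -> : y - d - 1 = (y - 1) - d by ring.
have := IH (y - 1) sT ltac:(lra) ltac:(lra); lra.
Qed.

(** The merge uses the smallest slopes first, so no split of the length [a + b] does better. The
    induction removes the smaller head, which a fractional [a] or [b] may use only in part. *)
Lemma slope_sum_merge_le S T a b : sorted <=%R S -> sorted <=%R T ->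
  0 <= a <= (size S)%:R -> 0 <= b <= (size T)%:R ->
  slope_sum (merge <=%R S T) (a + b) <= slope_sum S a + slope_sum T b.
Proof.
elim: S T a b => [|s S IHS] T a b.
  rewrite [merge _ _ _]/= => _ _ /itv0_eq0 -> _.
  by rewrite add0r /= add0r.
elim: T a b => [|t T IHT] a b sS sT.
  rewrite [merge _ _ _]/= => _ /itv0_eq0 ->.
  by rewrite addr0 [slope_sum [::] _]/= addr0.
have sS' := path_sorted sS; have sT' := path_sorted sT.
have allS : all (>= s) S by exact: order_path_min le_trans sS.
have allT : all (>= t) T by exact: order_path_min le_trans sT.
move=> /andP[a0 aS] /andP[b0 bT].
have nS0 : 0 <= (size S)%:R :> R := ler0n _ _.
have nT0 : 0 <= (size T)%:R :> R := ler0n _ _.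
have aS' : a <= (size S)%:R + 1 by rewrite natr1.
have bT' : b <= (size T)%:R + 1 by rewrite natr1.
rewrite merge_cons; case: ifPn => [st|].
  have allsT : all (>= s) (t :: T).
    by rewrite /= st; apply: sub_all allT => u /(le_trans st).
  have [a1|a1] := leP 1 a.
    rewrite slope_sum_ge1 ?(slope_sum_ge1 s S a) //; last by lra.
    have := IHS (t :: T) (a - 1) b sS' sT ltac:(lra) ltac:(lra).
    have -> : a - 1 + b = a + b - 1 by ring.
    lra.
  have [ab|ab] := leP (a + b) 1.
    rewrite !(slope_sum_le1 s) //; last by lra.
    by have := slope_sum_lb s (t :: T) b allsT ltac:(lra); lra.
  (* Here [a < 1 < a + b]: the first merged unit takes length [a] from [s] and borrows the missing
     [1 - a] from the end of the other list, whose slopes are at least [s]. *)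
  rewrite slope_sum_ge1 ?(slope_sum_le1 s S a) //; try lra.
  have := slope_sum_incr s (t :: T) b (1 - a) allsT ltac:(lra) ltac:(lra).
  have := IHS (t :: T) 0 (b - (1 - a)) sS' sT ltac:(lra) ltac:(lra).
  have -> : 0 + (b - (1 - a)) = a + b - 1 by ring.
  rewrite slope_sum0; lra.
rewrite -ltNge => /ltW ts.
have alltS : all (>= t) (s :: S).
  by rewrite /= ts; apply: sub_all allS => u /(le_trans ts).
have [b1|b1] := leP 1 b.
  rewrite slope_sum_ge1 ?(slope_sum_ge1 t T b) //; last by lra.
  have := IHT a (b - 1) sS sT' ltac:(lra) ltac:(lra).
  have -> : a + (b - 1) = a + b - 1 by ring.
  rewrite /=; lra.
have [ab|ab] := leP (a + b) 1.
  rewrite !(slope_sum_le1 t) //; last by lra.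
  by have := slope_sum_lb t (s :: S) a alltS ltac:(lra); lra.
rewrite slope_sum_ge1 ?(slope_sum_le1 t T b) //; try lra.
have := slope_sum_incr t (s :: S) a (1 - b) alltS ltac:(lra) ltac:(lra).
have := IHT (a - (1 - b)) 0 sS sT' ltac:(lra) ltac:(lra).
have -> : a - (1 - b) + 0 = a + b - 1 by ring.
rewrite slope_sum0; lra.
Qed.

(** Every prefix of the merge consists of a prefix of each list, and a fractional last unit belongs
    to one of the two. *)
Lemma slope_sum_merge_split S T y : 0 <= y <= (size S + size T)%:R ->
  exists a b, [/\ 0 <= a <= (size S)%:R, 0 <= b <= (size T)%:R, a + b = y &
    slope_sum (merge <=%R S T) y = slope_sum S a + slope_sum T b].
Proof.
elim: S T y => [|s S IHS] T y.
  rewrite add0n => yT; exists 0, y.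
  by rewrite lexx add0r [merge _ _ _]/= /= add0r.
elim: T y => [|t T IHT] y.
  rewrite addn0 => yT; exists y, 0.
  by rewrite lexx addr0 [merge _ _ _]/= /= addr0.
have nS : (size (s :: S))%:R = (size S)%:R + 1 :> R by rewrite natr1.
have nT : (size (t :: T))%:R = (size T)%:R + 1 :> R by rewrite natr1.
have nS0 : 0 <= (size S)%:R :> R := ler0n _ _.
have nT0 : 0 <= (size T)%:R :> R := ler0n _ _.
rewrite natrD nS nT => /andP[y0 yST]; rewrite merge_cons.
have [st|st] := leP s t.
  have [y1|y1] := leP y 1.
    exists y, 0; rewrite !slope_sum_le1 // ?mulr0 ?addr0; split=> //; lra.
  have [|a [b [a0 b0 ab e]]] := IHS (t :: T) (y - 1).
    by rewrite natrD nT; lra.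
  exists (a + 1), b; split=> //; try lra.
  rewrite slope_sum_ge1 ?e; last by lra.
  rewrite [slope_sum (s :: S) _]slope_sum_ge1; last by lra.
  by rewrite addrK addrA.
have [y1|y1] := leP y 1.
  exists 0, y; rewrite !slope_sum_le1 // ?mulr0 ?add0r; split=> //; lra.
have [|a [b [a0 b0 ab e]]] := IHT (y - 1).
  by rewrite natrD nS; lra.
exists a, (b + 1); split=> //; try lra.
rewrite slope_sum_ge1; last by lra.
rewrite [slope_sum (t :: T) _]slope_sum_ge1; last by lra.
rewrite addrK e; ring.
Qed.

End SlopeSum.

(** * Reflection, termwise sums and convexity of unit slopes *)

Section SlopeSumOperations.
Context {R : realType}.
Implicit Types (S T D : seq R) (a b d s x y v : R).

Lemma sumr_cons s S : \sum_(t <- s :: S) t = s + \sum_(t <- S) t.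
Proof. exact: big_cons. Qed.

Lemma slope_sum_rcons_le S s y : y <= (size S)%:R -> 0 <= y ->
  slope_sum (rcons S s) y = slope_sum S y.
Proof.
elim: S y => [|t S IH] y.
  by move=> y0 y0'; rewrite (itv0_eq0 y) ?slope_sum0 // y0'.
rewrite /= -natr1 => yS y0; case: ifPn => //; rewrite -ltNge => y1.
by rewrite IH //; lra.
Qed.

Lemma slope_sum_rcons_ge S s y : (size S)%:R <= y <= (size S)%:R + 1 ->
  slope_sum (rcons S s) y = \sum_(t <- S) t + s * (y - (size S)%:R).
Proof.
elim: S y => [|t S IH] y.
  rewrite /= big_nil => /andP[y0 y1].
  by rewrite add0r in y1; rewrite y1 subr0 add0r.
rewrite [size _]/= -natr1 => yS.
have S0 : 0 <= (size S)%:R :> R := ler0n _ _.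
rewrite slope_sum_ge1 -/(rcons _ _); last by lra.
rewrite IH; last by lra.
rewrite sumr_cons; ring.
Qed.

(** The graph is read from its right end. The subtracted sum is the value at [size T], so that the
    reflected function again starts at 0. *)
Lemma slope_sum_rev_opp T y : 0 <= y <= (size T)%:R ->
  slope_sum (rev (map -%R T)) y =
  slope_sum T ((size T)%:R - y) - \sum_(t <- T) t.
Proof.
elim: T y => [|t T IH] y; first by rewrite /= big_nil subr0.
have sz : size (rev (map -%R T)) = size T by rewrite size_rev size_map.
have S0 : 0 <= (size T)%:R :> R := ler0n _ _.
rewrite [size _]/= -natr1 map_cons rev_cons sumr_cons => yT.
have [yle|yge] := leP y (size T)%:R.
  rewrite slope_sum_rcons_le ?sz; [|lra..].
  rewrite IH ?(slope_sum_ge1 t); [|lra..].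
  have -> : (size T)%:R + 1 - y - 1 = (size T)%:R - y by ring.
  ring.
rewrite slope_sum_rcons_ge ?sz; last lra.
rewrite slope_sum_le1; last lra.
have -> : \sum_(u <- rev (map -%R T)) u = - \sum_(u <- T) u.
  by rewrite (perm_big _ (permEl (perm_rev _))) big_map sumrN.
ring.
Qed.

Lemma sorted_rev_opp T : sorted <=%R T -> sorted <=%R (rev (map -%R T)).
Proof.
move=> sT; rewrite rev_sorted sorted_map.
by apply: sub_sorted sT => u v' /=; rewrite lerN2.
Qed.

Lemma slope_sum_add S D y : size S = size D ->
  slope_sum [seq p.1 + p.2 | p <- zip S D] y = slope_sum S y + slope_sum D y.
Proof.
elim: S D y => [|s S IH] [|d D] y //=; first by rewrite addr0.
case=> /IH {}IH; case: ifP => _; rewrite ?IH; ring.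
Qed.

Lemma sorted_add S D : size S = size D -> sorted <=%R S -> sorted <=%R D ->
  sorted <=%R [seq p.1 + p.2 | p <- zip S D].
Proof.
case: S D => [|s S] [|d D] //= [].
elim: S s D d => [|s' S IH] s [|d' D] d //= [] eSD /andP[ss pS] /andP[dd pD].
by rewrite lerD //= IH.
Qed.

(** A supporting line at [y], with the slope of the unit containing [y]. Averaging it over two
    points gives convexity without comparing the units in which they lie. Membership of [c] serves
    the induction, where [s <= c] covers the points left of 1. *)
Lemma slope_sum_support S y : sorted <=%R S -> S != [::] ->
  0 <= y <= (size S)%:R ->
  exists2 c, c \in S & forall x, 0 <= x <= (size S)%:R ->
    slope_sum S y + c * (x - y) <= slope_sum S x.
Proof.
elim: S y => [//|s S IH] y sS _.
have allS : all (>= s) S by exact: order_path_min le_trans sS.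
have nS0 : 0 <= (size S)%:R :> R := ler0n _ _.
rewrite [size _]/= -natr1 => /andP[y0 yS].
have [y1|y1] := leP y 1.
  exists s; first exact: mem_head.
  move=> x /andP[x0 xS]; rewrite (slope_sum_le1 s S y) //.
  have [x1|x1] := leP x 1; first by rewrite slope_sum_le1 //; lra.
  rewrite slope_sum_ge1; last lra.
  have := slope_sum_lb s S (x - 1) allS ltac:(lra); lra.
have nil : S != [::].
  by apply: contraTneq yS => ->; rewrite -ltNge /= add0r.
have [c cS H] := IH (y - 1) (path_sorted sS) nil ltac:(lra).
exists c; first by rewrite inE cS orbT.
move=> x /andP[x0 xS]; rewrite (slope_sum_ge1 s S y); last lra.
have [x1|x1] := leP 1 x.
  by rewrite slope_sum_ge1 //; have := H (x - 1) ltac:(lra); lra.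
rewrite slope_sum_le1; last lra.
have := H 0 ltac:(lra); rewrite slope_sum0.
have := allP allS c cS => /= sc h.
nra.
Qed.

Lemma slope_sum_convex S x y t : sorted <=%R S ->
  0 <= x <= (size S)%:R -> 0 <= y <= (size S)%:R -> 0 <= t <= 1 ->
  slope_sum S (t * x + (1 - t) * y) <= t * slope_sum S x + (1 - t) * slope_sum S y.
Proof.
case: S => [|s S] sS xS yS t01; first by rewrite /= !mulr0 addr0.
have [|c _ H] := slope_sum_support (s :: S) (t * x + (1 - t) * y) sS isT.
  apply/andP; split; nra.
have hx := H x xS; have hy := H y yS.
set z := t * x + _ in hx hy *.
have : t * (slope_sum (s :: S) z + c * (x - z)) + (1 - t) * (slope_sum (s :: S) z + c * (y - z))
   <= t * slope_sum (s :: S) x + (1 - t) * slope_sum (s :: S) y.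
  by apply: lerD; apply: ler_wpM2l => //; lra.
have -> : t * (slope_sum (s :: S) z + c * (x - z)) + (1 - t) * (slope_sum (s :: S) z + c * (y - z))
   = slope_sum (s :: S) z by rewrite /z; ring.
by [].
Qed.

End SlopeSumOperations.

(** * Functions given by unit slopes *)

Definition pl_form (R : realType) (x v : R) (S : seq R) (z : R) : \bar R :=
  if x <= z <= x + (size S)%:R then (v + slope_sum S (z - x))%:E else +oo%E.
Arguments pl_form {R}.

Section PlForm.
Context {R : realType}.
Implicit Types (S T D : seq R) (a b d s x y z v : R).

Lemma pl_form_in x v S z : x <= z <= x + (size S)%:R ->
  pl_form x v S z = (v + slope_sum S (z - x))%:E.
Proof. by rewrite /pl_form => ->. Qed.

Lemma pl_form_ltoo x v S z :
  (pl_form x v S z < +oo)%E = (x <= z <= x + (size S)%:R).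
Proof. by rewrite /pl_form; case: ifP; rewrite ?ltry. Qed.

Lemma pl_form_gtNoo x v S z : (-oo < pl_form x v S z)%E.
Proof. by rewrite /pl_form; case: ifP; rewrite ?ltNyr. Qed.

Lemma pl_form_convex x v S : sorted <=%R S -> convex_efun (pl_form x v S).
Proof.
move=> sS y z t /andP[t0 t1].
(* The extreme weights are treated apart because 0 times infinity is 0; for weights strictly
   between, an infinite endpoint makes the right-hand side infinite. *)
have [->|tn0] := eqVneq t 0.
  by rewrite mul0r add0r subr0 mul1r mul0e mul1e add0e.
have [->|tn1] := eqVneq t 1.
  by rewrite subrr mul1r mul0r addr0 mul0e mul1e adde0.
have tp : 0 < t by rewrite lt_neqAle eq_sym tn0.
have tp1 : 0 < 1 - t by rewrite subr_gt0 lt_neqAle tn1.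
rewrite [pl_form x v S y]/pl_form [pl_form x v S z]/pl_form.
case: (boolP (x <= y <= _)) => ry; last first.
  by case: ifP => _; rewrite gt0_muley ?lte_fin // ?gt0_muley ?lte_fin // leey.
case: (boolP (x <= z <= _)) => rz; last by rewrite (gt0_muley (x := (1 - t)%:E)) ?lte_fin // leey.
rewrite pl_form_in; last by apply/andP; split; nra.
rewrite -!EFinM -EFinD lee_fin.
have := slope_sum_convex S (y - x) (z - x) t sS ltac:(lra) ltac:(lra) ltac:(lra).
have -> : t * (y - x) + (1 - t) * (z - x) = t * y + (1 - t) * z - x by ring.
lra.
Qed.

Lemma pl_form_shift x v S b z : pl_form (x - b) v S z = pl_form x v S (z + b).
Proof.
rewrite /pl_form; have -> : z - (x - b) = z + b - x by ring.
congr (if _ then _ else _).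
by apply/andP/andP => -[h1 h2]; split; lra.
Qed.

Lemma pl_form_opp x v S z :
  pl_form (- (x + (size S)%:R)) (v + \sum_(s <- S) s) (rev (map -%R S)) z =
  pl_form x v S (- z).
Proof.
rewrite /pl_form size_rev size_map.
have -> : (- (x + (size S)%:R) <= z <= - (x + (size S)%:R) + (size S)%:R) =
          (x <= - z <= x + (size S)%:R).
  by apply/andP/andP => -[h1 h2]; split; lra.
case: ifP => // h; rewrite slope_sum_rev_opp; last by lra.
have -> : (size S)%:R - (z - - (x + (size S)%:R)) = - z - x by ring.
by congr (_ %:E); ring.
Qed.

Lemma pl_form_merge_le x v S x' v' T a b : sorted <=%R S -> sorted <=%R T ->
  (pl_form (x + x') (v + v') (merge <=%R S T) (a + b) <=
   pl_form x v S a + pl_form x' v' T b)%E.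
Proof.
move=> sS sT; rewrite [pl_form x v S a]/pl_form [pl_form x' v' T b]/pl_form.
case: (boolP (x <= a <= _)) => ra; last first.
  by case: ifP => _; rewrite ?addye ?leey.
case: (boolP (x' <= b <= _)) => rb; last by rewrite addey ?leey.
rewrite pl_form_in; last by rewrite size_merge size_cat natrD; lra.
have := slope_sum_merge_le S T (a - x) (b - x') sS sT ltac:(lra) ltac:(lra).
have -> : a - x + (b - x') = a + b - (x + x') by ring.
rewrite -EFinD lee_fin; lra.
Qed.

Lemma pl_form_merge_split x v S x' v' T y :
  (pl_form (x + x') (v + v') (merge <=%R S T) y < +oo)%E ->
  exists a b, [/\ a + b = y, (pl_form x v S a < +oo)%E,
    (pl_form x' v' T b < +oo)%E &
    pl_form (x + x') (v + v') (merge <=%R S T) y =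
    (pl_form x v S a + pl_form x' v' T b)%E].
Proof.
rewrite pl_form_ltoo size_merge size_cat => h.
have h' : 0 <= y - (x + x') <= (size S + size T)%:R by lra.
have [a [b [a0 b0 ab e]]] := slope_sum_merge_split S T _ h'.
exists (x + a), (x' + b); rewrite !pl_form_ltoo; split; [lra.. |].
rewrite !pl_form_in ?size_merge ?size_cat //; [|lra..].
rewrite -EFinD e.
have -> : x + a - x = a by ring.
have -> : x' + b - x' = b by ring.
by congr (_%:E); ring.
Qed.

(** * Inf-convolution of finite families *)

Section Family.
Context {E : eqType}.
Implicit Types (l : seq E) (xs vs zt : E -> R) (Ss : E -> seq R).

(** Merging one list after the other suits proofs by induction. The program merges in another order,
    but two sorted permutations of the same slopes coincide. *)
Definition merges l Ss := foldr (fun e => merge <=%R (Ss e)) [::] l.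

Lemma sorted_merges l Ss : (forall e, e \in l -> sorted <=%R (Ss e)) ->
  sorted <=%R (merges l Ss).
Proof.
elim: l => //= e l IH h; apply: (merge_sorted le_total); first by apply: h; exact: mem_head.
by apply: IH => e' el; apply: h; rewrite inE el orbT.
Qed.

Lemma perm_merges l Ss : perm_eq (merges l Ss) (flatten (map Ss l)).
Proof.
by elim: l => //= e l IH; rewrite perm_merge perm_cat2l.
Qed.

Lemma pl_form_merges_le l xs vs Ss zt :
  (forall e, e \in l -> sorted <=%R (Ss e)) ->
  (pl_form (\sum_(e <- l) xs e) (\sum_(e <- l) vs e) (merges l Ss)
     (\sum_(e <- l) zt e)%R <=
   \sum_(e <- l) pl_form (xs e) (vs e) (Ss e) (zt e))%E.
Proof.
elim: l => [|e l IH] h.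
  by rewrite !big_nil /pl_form /= !addr0 lexx.
rewrite !big_cons; apply: le_trans (pl_form_merge_le _ _ _ _ _ _ _ _ _ _) _.
- by apply: h; exact: mem_head.
- by apply: sorted_merges => e' el; apply: h; rewrite inE el orbT.
- by apply: leeD2l; apply: IH => e' el; apply: h; rewrite inE el orbT.
Qed.

Lemma pl_form_merges_split l xs vs Ss y : uniq l ->
  (pl_form (\sum_(e <- l) xs e) (\sum_(e <- l) vs e) (merges l Ss) y < +oo)%E ->
  exists zt : E -> R, [/\ \sum_(e <- l) zt e = y,
    forall e, e \in l -> (pl_form (xs e) (vs e) (Ss e) (zt e) < +oo)%E &
    pl_form (\sum_(e <- l) xs e) (\sum_(e <- l) vs e) (merges l Ss) y =
    (\sum_(e <- l) pl_form (xs e) (vs e) (Ss e) (zt e))%E].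
Proof.
elim: l y => [|e l IH] y.
  rewrite !big_nil /= pl_form_ltoo add0r => _ /itv0_eq0 ->.
  exists (fun=> 0); rewrite !big_nil; split => //.
  by rewrite /pl_form /= !addr0 lexx.
rewrite !big_cons => /andP[el ul] /= /pl_form_merge_split[a [b [<- ha /(IH _ ul)]]].
move=> [zt [<- hzt ->]] ->; exists (fun e' => if e' == e then a else zt e').
have eqzt e' : e' \in l -> (if e' == e then a else zt e') = zt e'.
  by move=> e'l; case: eqP => // ee; rewrite -ee e'l in el.
split.
- by rewrite big_cons eqxx; congr (_ + _); apply: eq_big_seq.
- move=> e'; rewrite inE; have [->//|_ /=] := eqVneq e' e.
  exact: hzt.
- rewrite big_cons eqxx; congr (_ + _)%E; apply: eq_big_seq => e' e'l.
  by rewrite eqzt.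
Qed.

End Family.

(* The step is the inf-convolution of [z |-> A (z - a) + phi z] with the
   reflection of [B] (shifted by [b]). *)
Section Step.
Variables (phi : R -> R) (d : nat -> R).
Hypothesis phi_lin : forall (j : nat) x, j%:R <= x <= j%:R + 1 ->
  phi x = phi j%:R + d j * (x - j%:R).
Hypothesis d_homo : forall j, d j <= d j.+1.

Lemma sorted_increments j n : sorted <=%R [seq d k | k <- iota j n].
Proof.
elim: n j => //= n IH j; have := IH j.+1.
by case: n {IH} => //= n ->; rewrite d_homo.
Qed.

Lemma slope_sum_increments j n y : 0 <= y <= n%:R ->
  phi (j%:R + y) = phi j%:R + slope_sum [seq d k | k <- iota j n] y.
Proof.
elim: n j y => [|n IH] j y; first by move=> /itv0_eq0 ->; rewrite !addr0.
rewrite -natr1 => /andP[y0 yn] /=.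
have [y1|y1] := leP y 1.
  by rewrite (phi_lin j) //; [congr (_ + _ * _); ring | lra].
have -> : j%:R + y = j.+1%:R + (y - 1) by rewrite -natr1; ring.
rewrite IH; last by lra.
rewrite (phi_lin j j.+1%:R); rewrite -natr1; [ring | lra].
Qed.

Variables (xA : nat) (vA : R) (SA : seq R) (a : nat) (xB vB : R) (SB : seq R) (b : R).
Hypotheses (sA : sorted <=%R SA) (sB : sorted <=%R SB).

Definition loaded_slopes : seq R :=
  [seq p.1 + p.2 | p <- zip SA [seq d k | k <- iota (xA + a) (size SA)]].

(** The left end combines the smallest point of [A] with the largest point of [B]; accordingly the
    initial value contains the whole sum of [SB], the rise of [B] up to its right end. *)
Definition step_form : R -> \bar R :=
  pl_form ((xA + a)%:R - b - (xB + (size SB)%:R))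
    (vA + phi (xA + a)%:R + (vB + \sum_(s <- SB) s))
    (merge <=%R loaded_slopes (rev (map -%R SB))).

Lemma size_loaded_slopes : size loaded_slopes = size SA.
Proof. by rewrite size_map size_zip size_map size_iota minnn. Qed.

Lemma sorted_loaded_slopes : sorted <=%R loaded_slopes.
Proof.
apply: sorted_add => //; first by rewrite size_map size_iota.
exact: sorted_increments.
Qed.

Lemma pl_form_loaded y : pl_form (xA + a)%:R (vA + phi (xA + a)%:R) loaded_slopes y =
  (pl_form xA%:R vA SA (y - a%:R) + (phi y)%:E)%E.
Proof.
rewrite /pl_form size_loaded_slopes natrD.
have -> : (xA%:R + a%:R <= y <= xA%:R + a%:R + (size SA)%:R) =
  (xA%:R <= y - a%:R <= xA%:R + (size SA)%:R).
  by apply/andP/andP => -[h1 h2]; split; lra.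
case: ifPn => [h|_ //].
rewrite slope_sum_add ?size_map ?size_iota // -EFinD.
have -> : y - a%:R - xA%:R = y - (xA%:R + a%:R) by ring.
have e : y = (xA + a)%:R + (y - (xA + a)%:R) by ring.
rewrite [phi y](_ : _ = phi (xA + a)%:R +
    slope_sum [seq d k | k <- iota (xA + a) (size SA)] (y - (xA + a)%:R)).
  by rewrite natrD; congr (_%:E); ring.
rewrite -slope_sum_increments ?natrD; first by congr phi; ring.
lra.
Qed.

Lemma step_formE z : step_form z =
  pl_form ((xA + a)%:R + (- (xB + (size SB)%:R)))
    (vA + phi (xA + a)%:R + (vB + \sum_(s <- SB) s))
    (merge <=%R loaded_slopes (rev (map -%R SB))) (z + b).
Proof.
by rewrite -pl_form_shift /step_form; congr pl_form; ring.
Qed.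

Lemma step_form_le p q :
  (step_form (p + a%:R - q - b) <=
   pl_form xA%:R vA SA p + pl_form xB vB SB q + (phi (p + a%:R))%:E)%E.
Proof.
rewrite step_formE.
have -> : p + a%:R - q - b + b = (p + a%:R) + (- q) by ring.
apply: le_trans (pl_form_merge_le _ _ _ _ _ _ _ _ _ _) _.
- exact: sorted_loaded_slopes.
- exact: sorted_rev_opp.
rewrite pl_form_loaded pl_form_opp opprK addrK.
by rewrite -!addeA (addeC (phi _)%:E).
Qed.

Lemma step_form_split z : (step_form z < +oo)%E ->
  exists p q, [/\ z = p + a%:R - q - b, (pl_form xA%:R vA SA p < +oo)%E,
    (pl_form xB vB SB q < +oo)%E &
    step_form z =
    (pl_form xA%:R vA SA p + pl_form xB vB SB q + (phi (p + a%:R))%:E)%E].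
Proof.
rewrite step_formE => /pl_form_merge_split[y [q [yq hy hq ->]]].
rewrite pl_form_opp in hq *.
exists (y - a%:R), (- q); split => //.
- by have := congr1 (fun u => u - b) yq; rewrite addrK => <-; ring.
- move: hy; rewrite pl_form_loaded.
  by case: (pl_form xA%:R vA SA (y - a%:R)) => [r||]; rewrite ?ltry ?addye ?ltxx ?ltNyr.
- by rewrite pl_form_loaded subrK -!addeA (addeC (phi _)%:E).
Qed.

Lemma sorted_step : sorted <=%R (merge <=%R loaded_slopes (rev (map -%R SB))).
Proof.
apply: (merge_sorted le_total); first exact: sorted_loaded_slopes.
exact: sorted_rev_opp.
Qed.

End Step.
End PlForm.

(** * Load penalties *)

Section LoadPenalty.
Context {R : realType}.
Implicit Types (x y z t c al be : R).

(** Letting [r] tend to 0 stands in for a continuity argument. For positive [c], the choice of [r]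
    as [c] over [c] plus the absolute value of [al] plus 1 makes [r * al < c], a contradiction. *)
Lemma le0_of_le_scaled c al : (forall r, 0 < r < 1 -> c <= r * al) -> c <= 0.
Proof.
move=> h; rewrite leNgt; apply/negP => c0.
have a0 : 0 <= `|al| := normr_ge0 _.
have d0 : 0 < c + `|al| + 1 by lra.
have := h (c / (c + `|al| + 1)).
rewrite divr_gt0 //= ltr_pdivrMr // mul1r => /(_ ltac:(lra)).
rewrite mulrAC ler_pdivlMr //.
have := ler_norm al; nra.
Qed.

Variable phi : R -> R.
Hypothesis phi_incr : forall x y, 0 <= x -> x < y -> phi x < phi y.
Hypothesis phi_plc : pl_convex (extend_nneg phi) [set x | x \is a Num.int].

Lemma penalty_convex x y t : 0 <= x -> 0 <= y -> 0 <= t <= 1 ->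
  phi (t * x + (1 - t) * y) <= t * phi x + (1 - t) * phi y.
Proof.
case: phi_plc => + _ x0 y0 t01 => /(_ x y t t01).
rewrite /extend_nneg x0 y0 ifT -?EFinM -?EFinD ?lee_fin //.
by apply: addr_ge0; apply: mulr_ge0 => //; lra.
Qed.

(** The midpoint of the unit interval lies in some interval of the partition. Its ends are integers,
    so it contains the open unit interval; whether it contains [j] and [j + 1] is unknown. *)
Lemma penalty_affine_piece (j : nat) : exists al be,
  forall z, j%:R < z < j%:R + 1 -> phi z = al * z + be.
Proof.
have j0 : 0 <= j%:R :> R := ler0n _ _.
case: phi_plc => _ [s [cnt aff ends]].
have : (count (fun J : interval R => (j%:R + 2^-1)%R \in J) s)%N = 1%N.
  rewrite cnt /extend_nneg ifT ?ltry //; lra.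
move=> c1; have /hasP[J Js zJ] : has (fun J : interval R => (j%:R + 2^-1)%R \in J) s.
  by rewrite has_count c1.
have [al [be h]] := aff J Js; exists al, be => z zj.
have zJ' : z \in J.
  have [] := ends J Js; case: J {Js h} zJ => l r /=; rewrite !in_itv /=.
  move=> /andP[zl zr] El Er; apply/andP; split.
    case: l zl El => [b x|[]] //= zl /intrP[m xm].
    have xj : x <= j%:R.
      have : x <= j%:R + 2^-1 by move: zl; case: b => /= ; lra.
      rewrite xm -[j%:R]/(j%:Z%:~R) ler_int => mj.
      have : m%:~R < (j%:Z + 1)%:~R :> R by rewrite intrD; lra.
      by rewrite ltr_int ltzD1.
    by case: b {zl} => /=; lra.
  case: r zr Er => [b x|[]] //= zr /intrP[m xm].
  have xj : j%:R + 1 <= x.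
    have : j%:R + 2^-1 <= x by move: zr; case: b => /= ; lra.
    rewrite xm => mj.
    have : (j%:Z)%:~R < m%:~R :> R by rewrite -[X in X < _]/(j%:R); lra.
    by rewrite ltr_int -lezD1 -(ler_int R) intrD.
  by case: b {zr} => /=; lra.
have := h z zJ'; rewrite /extend_nneg ifT; last by lra.
by case.
Qed.

(** The affine formula is extended to both ends of the unit interval. Convexity alone would permit
    an upward jump of the value at 0; monotonicity rules it out. Each end takes one inequality from
    monotonicity and one from convexity. *)
Lemma penalty_linear (j : nat) x : j%:R <= x <= j%:R + 1 ->
  phi x = phi j%:R + (phi j.+1%:R - phi j%:R) * (x - j%:R).
Proof.
have j0 : 0 <= j%:R :> R := ler0n _ _.
rewrite -natr1; set a := j%:R in j0 *.
have [al [be h]] := penalty_affine_piece j; rewrite -/a in h.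
have e0 : phi a = al * a + be.
  apply/eqP; rewrite eq_le -subr_le0 -[X in _ && X]subr_le0; apply/andP; split.
    apply: (le0_of_le_scaled _ al) => r r01.
    have := h (a + r) ltac:(lra); have := phi_incr a (a + r) ltac:(lra) ltac:(lra); nra.
  apply: (le0_of_le_scaled _ (phi (a + 1) - phi a - al)) => r r01.
  have := h (a + r) ltac:(lra); have := penalty_convex (a + 1) a r ltac:(lra) ltac:(lra) ltac:(lra).
  have -> : r * (a + 1) + (1 - r) * a = a + r by ring.
  nra.
have e1 : phi (a + 1) = al * (a + 1) + be.
  apply/eqP; rewrite eq_le -subr_le0 -[X in _ && X]subr_le0; apply/andP; split.
    (* Convexity across the possible kink: [a + 1] is the mean of [a + 1 - r] and [a + 2] with
       weights 1/(1+r) and r/(1+r). *)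
    apply: (le0_of_le_scaled _ (phi (a + 2) - phi (a + 1) - al)) => r r01.
    have r10 : 0 < 1 + r by lra.
    have rv0 : 0 < (1 + r)^-1 by rewrite invr_gt0.
    have rv1 : (1 + r)^-1 <= 1 by rewrite invf_le1 //; lra.
    have := h (a + 1 - r) ltac:(lra).
    have := penalty_convex (a + 1 - r) (a + 2) (1 + r)^-1 ltac:(lra) ltac:(lra) ltac:(lra).
    have -> : (1 + r)^-1 * (a + 1 - r) + (1 - (1 + r)^-1) * (a + 2) = a + 1.
      by field; rewrite gt_eqF.
    move=> hc e; have : (1 + r) * phi (a + 1) <= phi (a + 1 - r) + r * phi (a + 2).
      have -> : phi (a + 1 - r) + r * phi (a + 2) =
        (1 + r) * ((1 + r)^-1 * phi (a + 1 - r) + (1 - (1 + r)^-1) * phi (a + 2)).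
        by field; rewrite gt_eqF.
      by rewrite ler_pM2l.
    rewrite e; lra.
  apply: (le0_of_le_scaled _ al) => r r01.
  have := h (a + 1 - r) ltac:(lra).
  have := phi_incr (a + 1 - r) (a + 1) ltac:(lra) ltac:(lra); lra.
move=> /andP[ax xa].
have -> : phi x = al * x + be.
  have [<-//|nax] := eqVneq a x.
  have [->//|nxa] := eqVneq x (a + 1).
  by apply: h; rewrite !lt_neqAle nax nxa ax.
rewrite e0 e1; ring.
Qed.

Lemma penalty_increments (j : nat) :
  phi j.+1%:R - phi j%:R <= phi j.+2%:R - phi j.+1%:R.
Proof.
have j0 : 0 <= j%:R :> R := ler0n _ _.
have := penalty_convex j%:R j.+2%:R 2^-1 ltac:(lra) (ler0n _ _) ltac:(lra).
have -> : 2^-1 * j%:R + (1 - 2^-1) * j.+2%:R = j.+1%:R :> R.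
  by rewrite -!natr1; field.
lra.
Qed.

End LoadPenalty.

(** * Representations by pieces *)

Section Represents.
Context {R : realType}.
Implicit Types (f : R -> \bar R) (s : seq (piece R)) (p q : piece R) (B : set R).
Implicit Types (S : seq R) (x v z : R).

(** Consecutive pieces share an endpoint, while a partition counts each point once. Only the first
    piece will keep its left end. *)
Definition piece_itv (closed : bool) p : interval R :=
  Interval (BSide closed (lo p)) (if hi p is r%:E then BRight r else BInfty _ false).

Lemma in_piece_itv c p z : ((lo p)%:E <= hi p)%E ->
  (z \in piece_itv c p) = (lo p < z ?<= if c) && (z%:E <= hi p)%E.
Proof.
rewrite /piece_itv in_itv /=; case: (hi p) => [r||] //=.
by rewrite !leey.
Qed.

Lemma well_formed_le s : well_formed s -> all (fun p => ((lo p)%:E <= hi p)%E) s.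
Proof.
case=> _ [|[p -> /= ->]]; last by rewrite lexx.
by apply: sub_all => p; exact: ltW.
Qed.

Lemma pieces_cover s p :
  path (fun p q : piece R => hi p == (lo q)%:E) p s ->
  all (fun p => ((lo p)%:E <= hi p)%E) (p :: s) ->
  [/\ ((lo p)%:E <= hi (last p s))%E,
   forall c z, count (fun J : interval R => z \in J)
        (piece_itv c p :: map (piece_itv false) s) =
        (lo p < z ?<= if c) && (z%:E <= hi (last p s))%E :> nat &
   forall z, has (fun p => in_piece p z) (p :: s) =
        (lo p <= z) && (z%:E <= hi (last p s))%E].
Proof.
elim: s p => [|q s IH] p.
  move=> _ /= /andP[lp _]; split=> // [c z|z]; last by rewrite orbF.
  by rewrite addn0 in_piece_itv.
move=> /= /andP[/eqP pq pth] /andP[lp al].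
have [lq cnt hs] := IH q pth al.
have lpq : (lo p <= lo q) by rewrite -lee_fin -pq.
split=> [|c z|z].
- by apply: le_trans lq; rewrite lee_fin.
- have := cnt false z; rewrite /= => ->.
  rewrite in_piece_itv // pq lee_fin.
  have [zq|zq] /= := leP z (lo q).
    have zl : (z%:E <= hi (last q s))%E by apply: le_trans lq; rewrite lee_fin.
    by rewrite zl !andbT addn0.
  have pz := le_lt_trans lpq zq.
  by case: c; rewrite andbF add0n /= ?pz ?(ltW pz).
- have := hs z; rewrite /= => ->; rewrite /in_piece pq lee_fin.
  have [zq|zq] /= := leP z (lo q).
    have zl : (z%:E <= hi (last q s))%E by apply: le_trans lq; rewrite lee_fin.
    rewrite zl !andbT; apply/orP/idP => [[//|]|->]; last by left.
    exact: le_trans.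
  rewrite andbF /= (ltW zq) (ltW (le_lt_trans lpq zq)) //.
Qed.

Lemma represents_ltoo s B f z : represents s B f ->
  (f z < +oo)%E = has (fun p => in_piece p z) s.
Proof.
case=> _ _ val out; apply/idP/hasP => [|[p ps pz]]; last first.
  by rewrite (val p z ps pz) ltry.
by move=> fz; apply/hasP; apply: contraTT fz => /out ->; rewrite ltxx.
Qed.

Lemma represents_pl_convex s B f :
  represents s B f -> convex_efun f -> pl_convex f B.
Proof.
move=> rep cf; split => //.
have [wf ends val out] := rep.
have wl := well_formed_le _ wf; have [srt _] := wf.
case: s => [|p s] in rep wf ends val out wl srt *.
  exists [::]; split => // z; rewrite (represents_ltoo _ _ _ z rep) //.
have [_ cnt hs] := pieces_cover _ _ srt wl.
exists (piece_itv true p :: map (piece_itv false) s).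
have piJ J : J \in piece_itv true p :: map (piece_itv false) s ->
    exists c q, q \in p :: s /\ J = piece_itv c q.
  rewrite inE => /orP[/eqP ->|/mapP[q qs ->]].
    by exists true, p; rewrite mem_head.
  by exists false, q; rewrite inE qs orbT.
split.
- by move=> z; rewrite cnt (represents_ltoo _ _ _ z rep) hs.
- move=> J /piJ[c [q [qs ->]]]; exists (slope q), (icpt q) => z.
  rewrite in_piece_itv; last exact: (allP wl).
  move=> /andP[zq zh]; apply: (val q z qs).
  by rewrite /in_piece zh andbT; case: c zq => //= /ltW.
- move=> J /piJ[c [q [qs ->]]] /=; have [? h] := ends q qs.
  by split=> //; case: (hi q) h => //= r; apply.
Qed.

(** Each piece is cut into [k] unit steps with its slope. The value [k = 0] is allowed for a
    function that is finite at a single point. *)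
Fixpoint unit_chain (n : nat) s S : Prop :=
  if s is p :: s' then
    exists k S', [/\ lo p = n%:R, hi p = (n + k)%:R%:E, S = nseq k (slope p) ++ S' &
      unit_chain (n + k) s' S']
  else S = [::].

(** The bound on [size s] is needed for the running time: a nondegenerate piece spans at least one
    unit, and the extra 1 accounts for a lone point. *)
Lemma represents_unit_chain s (u : nat) f : represents s (nat_upto u) f ->
  (forall z, (f z < +oo)%E -> z <= u%:R) -> s != [::] ->
  exists n S, [/\ unit_chain n s S, (n + size S <= u)%N & (size s <= (size S).+1)%N].
Proof.
move=> rep bnd; have [wf ends val _] := rep; have wl := well_formed_le _ wf.
have fin p : p \in s -> exists n k, [/\ lo p = n%:R, hi p = (n + k)%:R%:E & (n + k <= u)%N].
  move=> ps; have [[n nu en] hu] := ends p ps; have lep := allP wl p ps.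
  have [r er] : exists r, hi p = r%:E.
    case eh: (hi p) => [r||]; first by exists r.
      (* An unbounded piece would make [f] finite at this point, which lies beyond [u]. *)
      have z0 : lo p <= Num.max (lo p) (u%:R + 1) by rewrite le_max lexx.
      have := val p (Num.max (lo p) (u%:R + 1)) ps; rewrite /in_piece z0 eh leey.
      move=> /(_ isT) e; have := bnd (Num.max (lo p) (u%:R + 1)); rewrite e ltry.
      by move=> /(_ isT); rewrite ge_max => /andP[_]; lra.
    by move: lep; rewrite eh.
  have [m mu em] := hu r er.
  exists n, (m - n)%N; rewrite subnKC; first by rewrite er em.
  by move: lep; rewrite en er em lee_fin ler_nat.
have sz : size s = 1%N \/ all (fun p => ((lo p)%:E < hi p)%E) s.
  by case: wf => _ [|[p -> _]]; [right|left].
have [srt _] := wf => {wf wl rep bnd ends val}.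
have gen s' p n : {subset p :: s' <= s} -> lo p = n%:R ->
    path (fun p q : piece R => hi p == (lo q)%:E) p s' ->
    exists S, [/\ unit_chain n (p :: s') S, (n + size S <= u)%N &
      all (fun p => ((lo p)%:E < hi p)%E) (p :: s') -> (size (p :: s') <= size S)%N].
  elim: s' p n => [|q s' IH] p n sub en /=.
    move=> _; have [n' [k [en' eh nu]]] := fin p (sub p (mem_head _ _)).
    move: en'; rewrite en => /eqP; rewrite eqr_nat => /eqP nn'; subst n'.
    exists (nseq k (slope p)); split; rewrite ?size_nseq //.
      by exists k, [::]; rewrite cats0.
    by rewrite eh lte_fin ltr_nat andbT; lia.
  move=> /andP[/eqP pq pth].
  have [n' [k [en' eh nu]]] := fin p (sub p (mem_head _ _)).
  move: en'; rewrite en => /eqP; rewrite eqr_nat => /eqP nn'; subst n'.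
  have [||S [ch hS szS]] := IH q (n + k)%N _ _ pth.
    by move=> t ts; apply: sub; rewrite inE ts orbT.
    by move: pq; rewrite eh => -[].
  exists (nseq k (slope p) ++ S); split.
  - by exists k, S.
  - by rewrite size_cat size_nseq; lia.
  - rewrite eh lte_fin ltr_nat size_cat size_nseq /= in szS * => /andP[kp /szS].
    lia.
case: s fin sz srt gen => // p s fin sz srt gen _.
have [n [k [en _ _]]] := fin p (mem_head _ _).
have [S [ch hS szS]] := gen s p n (fun _ => id) en srt.
exists n, S; split => //; case: sz => [->//|/szS]; lia.
Qed.

Lemma slope_sum_nseq_le k a S y : 0 <= y <= k%:R ->
  slope_sum (nseq k a ++ S) y = a * y.
Proof.
elim: k y => [|k IH] y; first by move=> /itv0_eq0 ->; rewrite slope_sum0 mulr0.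
rewrite -natr1 => yk /=; case: ifPn => //; rewrite -ltNge => y1.
by rewrite IH; [ring | lra].
Qed.

Lemma slope_sum_nseq_ge k a S y : k%:R <= y ->
  slope_sum (nseq k a ++ S) y = a * k%:R + slope_sum S (y - k%:R).
Proof.
elim: k y => [|k IH] y; first by rewrite mulr0 add0r subr0.
have k0 : 0 <= k%:R :> R := ler0n _ _.
rewrite -natr1 => yk; rewrite slope_sum_ge1; last by lra.
rewrite -/(nseq k a ++ S) IH; last by lra.
have -> : y - 1 - k%:R = y - (k%:R + 1) by ring.
ring.
Qed.

Lemma unit_chain_value s S f n v z : unit_chain n s S ->
  (forall p z, p \in s -> in_piece p z -> f z = (slope p * z + icpt p)%:E) ->
  s != [::] -> f n%:R = v%:E -> n%:R <= z <= n%:R + (size S)%:R ->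
  f z = (v + slope_sum S (z - n%:R))%:E.
Proof.
elim: s S n v => // p s IH _ n v [k [S [en eh -> ch]]] val _ fn.
rewrite size_cat size_nseq natrD => /andP[nz zS].
have k0 : 0 <= k%:R :> R := ler0n _ _.
have fv z' : n%:R <= z' <= n%:R + k%:R -> f z' = (slope p * z' + icpt p)%:E.
  move=> hz; apply: val; first exact: mem_head.
  by rewrite /in_piece en eh natrD lee_fin.
have ev : v = slope p * n%:R + icpt p.
  by have := fv n%:R ltac:(lra); rewrite fn => -[].
have [zk|zk] := leP z (n%:R + k%:R).
  rewrite fv ?nz // slope_sum_nseq_le; last by lra.
  by congr (_%:E); rewrite ev; ring.
rewrite slope_sum_nseq_ge; last by lra.
have snil : s != [::].
  apply/eqP => s0; move: ch; rewrite s0 /= => S0; move: zS.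
  by rewrite S0 /= addr0; lra.
rewrite (IH S (n + k)%N (v + slope p * k%:R)) //.
- by rewrite natrD; congr (_%:E); rewrite -addrA; congr (_ + (_ + slope_sum S _)); ring.
- by move=> q z' qs; apply: val; rewrite inE qs orbT.
- by rewrite natrD fv ?lexx; [congr (_%:E); rewrite ev; ring | lra].
- by rewrite natrD; lra.
Qed.

Lemma unit_chain_range s S n z : unit_chain n s S ->
  has (fun p => in_piece p z) s -> n%:R <= z <= n%:R + (size S)%:R.
Proof.
elim: s S n => // p s IH _ n [k [S [en eh -> ch]]] /=.
rewrite size_cat size_nseq natrD /in_piece en eh natrD lee_fin.
have k0 : 0 <= k%:R :> R := ler0n _ _.
have S0 : 0 <= (size S)%:R :> R := ler0n _ _.
by move=> /orP[|/(IH _ _ ch)]; rewrite ?natrD; lra.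
Qed.

Lemma slope_sum_nat S k : (k < size S)%N ->
  slope_sum S k.+1%:R = slope_sum S k%:R + S`_k.
Proof.
elim: S k => // s S IH [|k] kS; first by rewrite slope_sum0 add0r /= lexx mulr1.
rewrite !slope_sum_ge1 ?ler1n // -[k.+2%:R]natr1 -[k.+1%:R]natr1 !addrK.
by rewrite natr1 IH // addrA.
Qed.

(** Midpoint convexity at three consecutive grid points compares two neighbouring slopes. *)
Lemma pl_form_sorted x v S : convex_efun (pl_form x v S) -> sorted <=%R S.
Proof.
move=> cf; apply/(sortedP 0) => k kS.
have kS' : k%:R + 2 <= (size S)%:R :> R.
  by rewrite -natrD ler_nat addn2.
have k0 : 0 <= k%:R :> R := ler0n _ _.
have := cf (x + k%:R) (x + (k%:R + 2)) 2^-1 ltac:(lra).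
have -> : 2^-1 * (x + k%:R) + (1 - 2^-1) * (x + (k%:R + 2)) = x + (k%:R + 1).
  by field.
rewrite !pl_form_in; [|lra..].
have xK t : x + t - x = t by ring.
rewrite -!EFinM -EFinD lee_fin !xK.
have -> : k%:R + 1 = k.+1%:R :> R by rewrite natr1.
have -> : k%:R + 2 = k.+2%:R :> R by rewrite -!natr1; ring.
have e1 := slope_sum_nat S k (ltnW kS); have e2 := slope_sum_nat S k.+1 kS; move=> h.
rewrite e2 e1 in h; lra.
Qed.

Lemma represents_pl_form s (u : nat) f : represents s (nat_upto u) f ->
  convex_efun f ->
  (forall z, (f z < +oo)%E -> z <= u%:R) -> s != [::] ->
  exists n S p s', [/\ s = p :: s', unit_chain n s S, lo p = n%:R,
     (n + size S <= u)%N /\ (size s <= (size S).+1)%N &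
     sorted <=%R S /\ f = pl_form n%:R (slope p * n%:R + icpt p) S].
Proof.
move=> rep cf bnd snil; have [wf ends val out] := rep.
have [n [S [ch nu sz]]] := represents_unit_chain _ _ _ rep bnd snil.
have [p [s' es]] : exists p s', s = p :: s' by case: (s) snil => // p s' _; exists p, s'.
have en : lo p = n%:R by move: ch; rewrite es => -[k [S' []]].
have ef : f = pl_form n%:R (slope p * n%:R + icpt p) S.
  apply/funext => z; rewrite /pl_form; case: ifPn => [hz|].
    apply: (unit_chain_value s) => //; apply: val; first by rewrite es mem_head.
    rewrite /in_piece en lexx /=; have := allP (well_formed_le _ wf) p.
    by rewrite en; apply; rewrite es mem_head.
  by move=> hz; apply: out; apply: contra hz; exact: unit_chain_range.
exists n, S, p, s'; split => //; split => //.
by apply: (pl_form_sorted n%:R (slope p * n%:R + icpt p)); rewrite -ef.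
Qed.

End Represents.

(** * Clipping to the capacity interval and output of pieces *)

Section Emit.
Context {R : realType}.
Implicit Types (S : seq R) (u g x v z : R) (p q : piece R).

Fixpoint emit_from u g x v S : seq (piece R) :=
  if S is s :: S' then
    if x + 1 <= u then
      ((x, (x + 1)%:E), (s + g, v - s * x)) :: emit_from u g (x + 1) (v + s) S'
    else [::]
  else [::].

(** For an integer [x], the first unit start that is not negative is 0 or the original [x], so no
    unit straddles 0. The cases [S] empty and [u <= x] leave a single point, the only situation in
    which a degenerate piece is well formed. *)
Fixpoint emit u g x v S : seq (piece R) :=
  if 0 <= x then
    if x <= u then
      if S is [::] then [:: ((x, x%:E), (g, v))]
      else if u <= x then [:: ((x, x%:E), (g, v))] else emit_from u g x v S
    else [::]
  else if S is s :: S' then emit u g (x + 1) (v + s) S' else [::].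

Definition clipped u g x v S z : \bar R :=
  ((if (0 <= z <= u)%R then (g * z)%:E else +oo) + pl_form x v S z)%E.

Lemma pl_form_behead x v s S z : x + 1 <= z ->
  pl_form x v (s :: S) z = pl_form (x + 1) (v + s) S z.
Proof.
move=> xz; rewrite /pl_form /= -natr1.
have S0 : 0 <= (size S)%:R :> R := ler0n _ _.
have -> : (x <= z <= x + ((size S)%:R + 1)) = (x + 1 <= z <= x + 1 + (size S)%:R).
  by apply/andP/andP => -[h1 h2]; split; lra.
case: ifP => // h; rewrite -/(slope_sum (s :: S) (z - x)) slope_sum_ge1; last by lra.
have -> : z - x - 1 = z - (x + 1) by ring.
by rewrite addrA.
Qed.

Lemma clipped_in u g x v S z : 0 <= z <= u -> x <= z <= x + (size S)%:R ->
  clipped u g x v S z = (g * z + (v + slope_sum S (z - x)))%:E.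
Proof. by move=> zu zS; rewrite /clipped zu pl_form_in. Qed.

Lemma emit_from_spec (u j : nat) g v S (s := emit_from u%:R g j%:R v S) :
  [/\ forall p, hi p = j%:R%:E -> path (fun p q : piece R => hi p == (lo q)%:E) p s,
      all (fun p => ((lo p)%:E < hi p)%E) s,
      forall p, p \in s -> nat_upto u (lo p) /\ (forall r, hi p = r%:E -> nat_upto u r),
      forall p z, p \in s -> in_piece p z -> j%:R <= z /\
        clipped u%:R g j%:R v S z = (slope p * z + icpt p)%:E &
      s != [::] -> forall z, j%:R <= z <= u%:R -> z <= j%:R + (size S)%:R ->
         has (fun p => in_piece p z) s].
Proof.
rewrite {}/s; elim: S j v => [|s S IH] j v //.
have S0 : 0 <= (size S)%:R :> R := ler0n _ _.
have j0 : 0 <= j%:R :> R := ler0n _ _.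
rewrite [emit_from _ _ _ _ _]/=; case: ifPn => // ju; rewrite natr1.
have [h1 h2 h3 h4 h5] := IH j.+1 (v + s); split.
- by move=> p ep /=; rewrite ep eqxx /= h1.
- by rewrite /= h2 andbT lte_fin ltr_nat.
- move=> p; rewrite inE => /orP[/eqP ->|/h3//].
  have ju' : (j < u)%N by move: ju; rewrite natr1 ler_nat.
  split; first by exists j => //; exact: ltnW.
  by move=> r [<-]; exists j.+1.
- move=> p z; rewrite inE => /orP[/eqP ->|ps pz].
    rewrite /in_piece /lo /hi /slope /icpt /= lee_fin -natr1 => /andP[jz zj].
    split=> //; rewrite clipped_in; [|lra..|by rewrite /= -natr1; lra].
    by rewrite slope_sum_le1; [congr (_%:E); ring|lra].
  have [jz e] := h4 p z ps pz; split; first by apply: le_trans jz; rewrite ler_nat.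
  by rewrite -e /clipped pl_form_behead natr1.
- move=> _ z zu; rewrite /= -natr1 => zS.
  rewrite {1}/in_piece /lo /hi /= lee_fin -natr1.
  have [zj|zj] := leP z (j%:R + 1); first by case/andP: zu => -> _.
  rewrite andbF /=; case: S {IH} S0 zS h1 h2 h3 h4 h5 => [|s' S] S0 zS _ _ _ _ h5.
    by move: zS; rewrite /= add0r; lra.
  have zu' : j%:R + 2 <= u%:R :> R.
    case/andP: zu => _ zu; have : (j.+1)%:R < u%:R :> R by rewrite -natr1; lra.
    by rewrite ltr_nat -natrD ler_nat addn2.
  rewrite -natr1 in h5; apply: h5; last 2 first.
  - lra.
  - lra.
  by rewrite /= ifT //; lra.
Qed.

Lemma represents_point (u k : nat) g w (f : R -> \bar R) : (k <= u)%N ->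
  (forall z, f z = if z == k%:R then (g * z + w)%:E else +oo%E) ->
  represents [:: ((k%:R, k%:R%:E), (g, w))] (nat_upto u) f.
Proof.
move=> ku e; split.
- by split=> //; right; exists ((k%:R, k%:R%:E), (g, w)).
- move=> p; rewrite inE => /eqP ->; rewrite /lo /hi /=.
  by split=> [|r [<-]]; exists k.
- move=> p z; rewrite inE => /eqP ->; rewrite /in_piece /lo /hi /slope /icpt /=.
  by rewrite lee_fin -eq_le eq_sym e => ->.
- move=> z; rewrite /= orbF /in_piece /lo /hi /= lee_fin -eq_le eq_sym e.
  by move/negPf => ->.
Qed.

Lemma represents_nil (B : set R) (f : R -> \bar R) :
  (forall z, f z = +oo%E) -> represents [::] B f.
Proof. by move=> e; split => //; split => //; left. Qed.

Lemma clipped_oo u g x v S z : ~~ ((0 <= z <= u) && (x <= z <= x + (size S)%:R)) ->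
  clipped u g x v S z = +oo%E.
Proof.
rewrite /clipped; case: ifP => _ /=.
  by rewrite -(pl_form_ltoo x v); case: (pl_form x v S z) => //= r; rewrite ltry.
by have := pl_form_gtNoo x v S z; case: (pl_form x v S z).
Qed.

Lemma emit_represents (u : nat) (j : int) g v S :
  represents (emit u%:R g j%:~R v S) (nat_upto u) (clipped u%:R g j%:~R v S).
Proof.
have u0 : 0 <= u%:R :> R := ler0n _ _.
elim: S j v => [|s S IH] j v.
  case: j => k; last first.
    rewrite /= ifF; last by apply/negP; rewrite ler0z.
    apply: represents_nil => z; apply: clipped_oo; rewrite /= addr0.
    have : (Negz k)%:~R < 0 :> R by rewrite ltrz0.
    by move=> h; apply/negP; lra.
  rewrite -pmulrn /= ler0n ler_nat; case: leqP => ku.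
    apply: represents_point => // z; have k0 : 0 <= k%:R :> R := ler0n _ _.
    have ku' : k%:R <= u%:R :> R by rewrite ler_nat.
    case: eqVneq => [->|zk].
      by rewrite clipped_in; [rewrite subrr /= addr0|lra|rewrite /= addr0; lra].
    apply: clipped_oo; rewrite addr0 -eq_le [k%:R == _]eq_sym (negPf zk).
    by rewrite andbF.
  apply: represents_nil => z; apply: clipped_oo; rewrite /= addr0.
  have : u%:R < k%:R :> R by rewrite ltr_nat.
  by move=> h; apply/negP; lra.
have S0 : 0 <= (size S)%:R :> R := ler0n _ _.
case: j => k; last first.
  (* Dropping the first unit of a form with a negative integer start changes nothing on the capacity
     interval, since the next start is still at most 0. *)
  rewrite /= ifF; last by apply/negP; rewrite ler0z.
  have -> : (Negz k)%:~R + 1 = (Negz k + 1)%:~R :> R by rewrite intrD.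
  rewrite (_ : clipped _ _ _ _ _ = clipped u%:R g (Negz k + 1)%:~R (v + s) S) //.
  apply/funext => z; rewrite /clipped; case: ifP => [/andP[z0 zu]|_].
    congr (_ + _)%E; rewrite pl_form_behead ?intrD //.
    apply: le_trans z0; rewrite -[X in _ + X]/(1%:~R) -intrD lerz0; lia.
  have := pl_form_gtNoo (Negz k)%:~R v (s :: S) z.
  have := pl_form_gtNoo (Negz k + 1)%:~R (v + s) S z.
  by case: (pl_form _ _ _ _) => // [r|]; case: (pl_form _ _ _ _).
rewrite -pmulrn /emit -/emit ler0n ler_nat; case: (leqP k u) => ku; last first.
  apply: represents_nil => z; apply: clipped_oo.
  have : u%:R < k%:R :> R by rewrite ltr_nat.
  by move=> h; apply/negP; lra.
have k0 : 0 <= k%:R :> R := ler0n _ _.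
rewrite ler_nat; case: (leqP u k) => uk.
  have {uk ku} -> : k = u by apply/eqP; rewrite eqn_leq ku uk.
  apply: represents_point => // z.
  case: eqVneq => [->|zk].
    by rewrite clipped_in; [rewrite subrr slope_sum0 addr0|lra|rewrite /= -natr1; lra].
  by apply: clipped_oo; apply: contra zk; rewrite eq_le; lra.
have [h1 h2 h3 h4 h5] := emit_from_spec u k g v (s :: S).
have ne : emit_from u%:R g k%:R v (s :: S) != [::].
  by rewrite /= ifT // natr1 ler_nat.
split.
- split; last by left.
  (* A dummy predecessor ending at [k] turns the path property into sortedness. *)
  exact: path_sorted (h1 ((0, k%:R%:E), (0, 0)) erefl).
- exact: h3.
- by move=> p z ps pz; have [] := h4 p z ps pz.
- move=> z; apply: contraNeq => fz.
  have [/andP[zu zS]|/clipped_oo e] := boolP ((0 <= z <= u%:R) &&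
    (k%:R <= z <= k%:R + (size (s :: S))%:R)).
    by apply: h5 => //; lra.
  by rewrite e eqxx in fz.
Qed.

End Emit.

(** * Load penalties as lists of pieces with integer ends *)

Section LoadChain.
Context {R : realType}.
Variable phi : R -> R.

(** The strict inequality [n < m] means that skipping a piece advances by at least one unit. This
    bounds the work in [f_advance] independently of the number of pieces. *)
Fixpoint load_chain (n : nat) (s : seq (piece R)) : Prop :=
  if s is p :: s' then
    [/\ lo p = n%:R,
        forall z, in_piece p z -> phi z = slope p * z + icpt p &
        (hi p = +oo%E) \/
        (exists m, [/\ (n < m)%N, hi p = m%:R%:E & load_chain m s'])]
  else False.

Lemma represents_load_chain s :
  represents s [set x | x \is a Num.int] (extend_nneg phi) -> load_chain 0 s.
Proof.
move=> rep; have [wf ends val _] := rep; have wl := well_formed_le _ wf.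
have fin z : 0 <= z -> has (fun p => in_piece p z) s.
  by move=> z0; rewrite -(represents_ltoo _ _ _ z rep) /extend_nneg z0 ltry.
have pos p z : p \in s -> in_piece p z -> 0 <= z.
  move=> ps pz; have := val p z ps pz; rewrite /extend_nneg.
  by case: ifP.
have lo_in p : p \in s -> in_piece p (lo p).
  by move=> ps; rewrite /in_piece lexx; exact: (allP wl).
(* A single degenerate piece cannot contain both 0 and 1, where the penalty is finite. *)
have lts : all (fun p => ((lo p)%:E < hi p)%E) s.
  case: wf => _ [//|[p es ep]].
  have := fin 0 (lexx _); have := fin 1 ler01.
  by rewrite es /= !orbF /in_piece ep !lee_fin lte_fin ltxx andFb; clear; lra.
have [srt _] := wf.
have gen p s' n : {subset p :: s' <= s} -> lo p = n%:R ->
    path (fun p q : piece R => hi p == (lo q)%:E) p s' ->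
    (forall z, n%:R < z -> has (fun p => in_piece p z) (p :: s')) ->
    load_chain n (p :: s').
  elim: s' p n => [|q s' IH] p n sub en pth cov.
    have ps := sub p (mem_head _ _).
    split=> //.
      move=> z pz; have := val p z ps pz; rewrite /extend_nneg (pos p z) //.
      by case.
    left; have lep := allP wl p ps; case eh: (hi p) lep => [r||] //= lep.
    have nr : n%:R < Num.max (n%:R) r + 1 by rewrite ltr_pwDr // le_max lexx.
    have := cov _ nr; rewrite /= orbF /in_piece eh lee_fin => /andP[_].
    have : r <= Num.max n%:R r by rewrite le_max lexx orbT.
    by move=> h1 h2; exfalso; clear -h1 h2; lra.
  have ps := sub p (mem_head _ _); have lep := allP wl p ps.
  have qs : q \in s by apply: sub; rewrite !inE eqxx orbT.
  have wl' : all (fun p => ((lo p)%:E <= hi p)%E) (q :: s').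
    by apply/allP => t ts; apply: (allP wl); apply: sub; rewrite inE ts orbT.
  case/andP: pth => /eqP pq pth.
  split=> //.
    move=> z pz; have := val p z ps pz; rewrite /extend_nneg (pos p z) //.
    by case.
  right; have [qint _] := ends q qs; have /intrP[m em] : lo q \is a Num.int := qint.
  have q0 : 0 <= lo q by apply: (pos q) => //; exact: lo_in.
  move: q0; rewrite em ler0z; case: m em => // m em _.
  exists m; rewrite pq em.
  have nm : (n < m)%N.
    have := lep; rewrite pq em en lee_fin -[_%:~R]/(m%:R) ler_nat leq_eqVlt.
    case/orP => // /eqP nm; have := allP lts p ps.
    by rewrite pq en em lte_fin -nm ltxx.
  split=> //; apply: IH => //.
  - by move=> t ts; apply: sub; rewrite inE ts orbT.
  - move=> z mz; have /cov/orP[|//] : n%:R < z by apply: lt_trans mz; rewrite ltr_nat.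
    by rewrite /in_piece pq em lee_fin => /andP[_]; rewrite leNgt mz.
case: s srt fin gen wl pos lo_in {rep wf ends val lts} => [|p s] srt fin gen wl pos lo_in.
  by have := fin 0 (lexx _).
have p0 : lo p = 0.
  apply/eqP; rewrite eq_le (pos p) ?mem_head ?lo_in ?mem_head // andbT.
  have [_ _ hs] := pieces_cover _ _ srt wl.
  by have := fin 0 (lexx _); rewrite hs => /andP[].
apply: gen => //.
by move=> z z0; apply: fin; exact: ltW.
Qed.
End LoadChain.

(** * The program *)

(* f0, ..., f14 denote the functions in the order of min_sum_program below. *)
Local Notation V := Var.

(* f1 (x, (h, (a, acc))): prepends to acc one copy of a per unit step from x to h. *)
Definition f_fill : expr :=
  Case (V 0) MkNil (Case (V 1) MkNil (Case (V 1) MkNil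
    (IfLe (Arith Add (V 4) One) (V 2)
      (MkPair (V 0) (Call 1 (MkPair (Arith Add (V 4) One) (MkPair (V 2) (MkPair (V 0) (V 1))))))
      (V 1)))).

(* f2 ps: the unit slopes of the pieces ps. *)
Definition f_expand : expr :=
  Case (V 0) MkNil (Case (V 0) MkNil (Case (V 0) MkNil (Case (V 1) MkNil (Case (V 5) MkNil
    (Call 1 (MkPair (V 4) (MkPair (V 2) (MkPair (V 0) (Call 2 (V 9)))))))))).

(* f3 ps = (l, (a * l + b, f2 ps)), where ((l, h), (a, b)) is the head of ps. *)
Definition f_parse : expr :=
  Case (V 0) MkNil (Case (V 0) MkNil (Case (V 0) MkNil (Case (V 3) MkNil
    (MkPair (V 2) (MkPair (Arith Add (Arith Mul (V 0) (V 2)) (V 1)) (Call 2 (V 8))))))).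

(* f4: f3 applied to each element of a list. *)
Definition f_parse_all : expr :=
  Case (V 0) MkNil (MkPair (Call 3 (V 0)) (Call 4 (V 1))).

(* f5 (S, T): merges two sorted lists. *)
Definition f_merge : expr :=
  Case (V 0) MkNil (Case (V 0) (V 1) (Case (V 3) (V 2)
    (IfLe (V 2) (V 0)
      (MkPair (V 2) (Call 5 (MkPair (V 3) (V 5))))
      (MkPair (V 0) (Call 5 (MkPair (V 4) (V 1))))))).

(* f6 ((x, (v, S)), (x', (v', S'))) = (x + x', (v + v', f5 (S, S'))) *)
Definition f_convolve : expr :=
  Case (V 0) MkNil (Case (V 0) MkNil (Case (V 1) MkNil (Case (V 5) MkNil (Case (V 1) MkNil
    (MkPair (Arith Add (V 6) (V 2)) (MkPair (Arith Add (V 4) (V 0))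
       (Call 5 (MkPair (V 5) (V 1))))))))).

(* f7: replaces consecutive pairs f, g of a list by f6 (f, g). *)
Definition f_pairs : expr :=
  Case (V 0) MkNil (Case (V 1) (V 2)
    (MkPair (Call 6 (MkPair (V 2) (V 0))) (Call 7 (V 1)))).

(* f8: iterates f7 until one element is left; (0, (0, nil)) on the empty list. *)
Definition f_reduce : expr :=
  Case (V 0) (MkPair Zero (MkPair Zero MkNil)) (Case (V 1) (V 0) (Call 8 (Call 7 (V 4)))).

(* f9 (x, ps): drops the leading pieces that end at or before x. *)
Definition f_advance : expr :=
  Case (V 0) MkNil (Case (V 1) MkNil (Case (V 0) MkNil (Case (V 0) MkNil
    (Case (V 1) (V 7) (IfLe (V 0) (V 8) (Call 9 (MkPair (V 8) (V 7))) (V 9)))))).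

(* f10 (w, (x, (S, ps))): adds to the k-th element of S the slope on [x + k, x + k + 1]
   of w times the function given by ps. *)
Definition f_load : expr :=
  Case (V 0) MkNil (Case (V 1) MkNil (Case (V 1) MkNil (Case (V 0) MkNil
    (Let (Call 9 (MkPair (V 4) (V 3)))
      (Case (V 0) MkNil (Case (V 0) MkNil (Case (V 1) MkNil
        (MkPair (Arith Add (V 7) (Arith Mul (V 13) (V 0)))
          (Call 10 (MkPair (V 13) (MkPair (Arith Add (V 11) One) (MkPair (V 8) (V 6))))))))))))).

(* f11 (S, (x, (v, acc))): for acc = nil, the form (x - size S, (v + sum S, rev (- S))). *)
Definition f_reflect : expr :=
  Case (V 0) MkNil (Case (V 1) MkNil (Case (V 2) (V 3) (Case (V 3) MkNil
    (Call 11 (MkPair (V 3) (MkPair (Arith Defs.Sub (V 4) One)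
      (MkPair (Arith Add (V 0) (V 2)) (MkPair (Arith Defs.Sub Zero (V 2)) (V 1))))))))).

(* f12 (u, (g, (x, (v, S)))): computes emit_from. *)
Definition f_emit_from : expr :=
  Case (V 0) MkNil (Case (V 1) MkNil (Case (V 1) MkNil (Case (V 1) MkNil (Case (V 1) MkNil
    (IfLe (Arith Add (V 4) One) (V 8)
      (MkPair
        (MkPair (MkPair (V 4) (MkPair (Arith Add (V 4) One) MkNil))
          (MkPair (Arith Add (V 0) (V 6)) (Arith Defs.Sub (V 2) (Arith Mul (V 0) (V 4)))))
        (Call 12 (MkPair (V 8) (MkPair (V 6) (MkPair (Arith Add (V 4) One)
          (MkPair (Arith Add (V 2) (V 0)) (V 1)))))))
      MkNil))))).

(* f13 (u, (g, (x, (v, S)))): computes emit. *)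
Definition f_emit : expr :=
  let point x g v :=
    MkPair (MkPair (MkPair (V x) (MkPair (V x) MkNil)) (MkPair (V g) (V v))) MkNil in
  Case (V 0) MkNil (Case (V 1) MkNil (Case (V 1) MkNil (Case (V 1) MkNil
    (IfLe Zero (V 2)
      (IfLe (V 2) (V 6)
        (Case (V 1) (point 2 4 0)
          (IfLe (V 8) (V 4) (point 4 6 2) (Call 12 (V 10))))
        MkNil)
      (Case (V 1) MkNil
        (Call 13 (MkPair (V 8) (MkPair (V 6) (MkPair (Arith Add (V 4) One)
          (MkPair (Arith Add (V 2) (V 0)) (V 1))))))))))).

(* f14 (mA, (a, (mB, (b, (ps, (w, (u, g))))))): the update, from the lists of messages
   mA and mB, the load penalty ps, the capacity u and the slope g of the edge function. *)
Definition f_update : expr :=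
  Case (V 0) MkNil (Case (V 1) MkNil (Case (V 1) MkNil (Case (V 1) MkNil (Case (V 1) MkNil
   (Case (V 1) MkNil (Case (V 1) MkNil
    (Let (Call 8 (Call 4 (V 12)))
    (Case (V 0) MkNil (Case (V 1) MkNil
    (Let (Arith Add (V 2) (V 15))
    (Let (Call 9 (MkPair (V 0) (V 10)))
    (Case (V 0) MkNil (Case (V 0) MkNil (Case (V 1) MkNil
    (Let (MkPair (Arith Defs.Sub (V 7) (V 19))
           (MkPair (Arith Add (V 8) (Arith Mul (V 15) (Arith Add (Arith Mul (V 0) (V 7)) (V 1))))
             (Call 10 (MkPair (V 15) (MkPair (V 7) (MkPair (V 9) (V 6)))))))
    (Let (Call 8 (Call 4 (V 22)))
    (Case (V 0) MkNil (Case (V 1) MkNil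
    (Call 13 (MkPair (V 19) (MkPair (V 20) (Call 6 (MkPair (V 5)
      (Call 11 (MkPair (V 1) (MkPair (Arith Defs.Sub Zero (V 2)) (MkPair (V 0) MkNil))))))))
    ))))))))))))))))))).

(* f0: f14 with mA the incoming messages, a = r_i and b = 0 if e leaves i; with mA the
   outgoing messages, a = 0 and b = r_i otherwise. *)
Definition f_main : expr :=
  Case (V 0) MkNil (Case (V 1) MkNil (Case (V 1) MkNil (Case (V 1) MkNil (Case (V 1) MkNil
   (Case (V 1) MkNil (Case (V 1) MkNil (Case (V 1) MkNil
    (Let (MkPair (V 4) (MkPair (V 14) (MkPair (V 8) (Arith Mul (Arith Defs.Sub One (V 14)) (V 10)))))
    (IfLe (V 7) Zero
      (Call 14 (MkPair (V 1) (MkPair Zero (MkPair (V 3) (MkPair (V 13) (V 0))))))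
      (Call 14 (MkPair (V 3) (MkPair (V 13) (MkPair (V 1) (MkPair Zero (V 0)))))))
    )))))))).

Definition min_sum_program : program :=
  [:: f_main; f_fill; f_expand; f_parse; f_parse_all; f_merge; f_convolve; f_pairs;
      f_reduce; f_advance; f_load; f_reflect; f_emit_from; f_emit; f_update].

(** * Evaluation of the program with cost bounds *)

Section Runs.
Context {R : realType}.
Implicit Types (env : seq (value R)) (v : value R).

Definition runs env a v n :=
  exists2 k, evaluates min_sum_program env a v k & (k <= n)%N.

Definition calls f v1 v n := exists2 body, onth min_sum_program f = Some body &
  runs [:: v1] body v n.

Lemma runs_leq env a v n n' : runs env a v n -> (n <= n')%N -> runs env a v n'.
Proof. by move=> [k ev kn] nn'; exists k => //; exact: leq_trans nn'. Qed.

Lemma calls_leq f v1 v n n' : calls f v1 v n -> (n <= n')%N -> calls f v1 v n'.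
Proof. by move=> [b eb rb] nn'; exists b => //; exact: runs_leq nn'. Qed.

Lemma calls_body body f v1 v n n' : onth min_sum_program f = Some body ->
  runs [:: v1] body v n -> (n <= n')%N -> calls f v1 v n'.
Proof. by move=> eb rb nn'; exists body => //; exact: runs_leq nn'. Qed.

Lemma runs_var env j v : onth env j = Some v -> runs env (Var j) v 1.
Proof. by exists 1%N => //; constructor. Qed.

Lemma runs_zero env : runs env Zero (VNum 0) 1.
Proof. by exists 1%N => //; constructor. Qed.

Lemma runs_one env : runs env One (VNum 1) 1.
Proof. by exists 1%N => //; constructor. Qed.

Lemma runs_nil env : runs env MkNil VNil 1.
Proof. by exists 1%N => //; constructor. Qed.

Lemma runs_add env a1 a2 x1 x2 n1 n2 : runs env a1 (VNum x1) n1 ->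
  runs env a2 (VNum x2) n2 -> runs env (Arith Add a1 a2) (VNum (x1 + x2)) (n1 + n2).+1.
Proof.
move=> [k1 e1 l1] [k2 e2 l2]; exists (k1 + k2).+1; last by rewrite ltnS leq_add.
exact: EvalArith e1 e2 _.
Qed.

Lemma runs_sub env a1 a2 x1 x2 n1 n2 : runs env a1 (VNum x1) n1 ->
  runs env a2 (VNum x2) n2 -> runs env (Arith Defs.Sub a1 a2) (VNum (x1 - x2)) (n1 + n2).+1.
Proof.
move=> [k1 e1 l1] [k2 e2 l2]; exists (k1 + k2).+1; last by rewrite ltnS leq_add.
exact: EvalArith e1 e2 _.
Qed.

Lemma runs_mul env a1 a2 x1 x2 n1 n2 : runs env a1 (VNum x1) n1 ->
  runs env a2 (VNum x2) n2 -> runs env (Arith Mul a1 a2) (VNum (x1 * x2)) (n1 + n2).+1.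
Proof.
move=> [k1 e1 l1] [k2 e2 l2]; exists (k1 + k2).+1; last by rewrite ltnS leq_add.
exact: EvalArith e1 e2 _.
Qed.

Lemma runs_pair env a1 a2 v1 v2 n1 n2 : runs env a1 v1 n1 ->
  runs env a2 v2 n2 -> runs env (MkPair a1 a2) (VPair v1 v2) (n1 + n2).+1.
Proof.
move=> [k1 e1 l1] [k2 e2 l2]; exists (k1 + k2).+1; last by rewrite ltnS leq_add.
exact: EvalMkPair e1 e2.
Qed.

Lemma runs_let env a1 a2 v1 v2 n1 n2 : runs env a1 v1 n1 ->
  runs (v1 :: env) a2 v2 n2 -> runs env (Let a1 a2) v2 (n1 + n2).+1.
Proof.
move=> [k1 e1 l1] [k2 e2 l2]; exists (k1 + k2).+1; last by rewrite ltnS leq_add.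
exact: EvalLet e1 e2.
Qed.

Lemma runs_le env a1 a2 a3 a4 x1 x2 v n1 n2 n : runs env a1 (VNum x1) n1 ->
  runs env a2 (VNum x2) n2 -> x1 <= x2 -> runs env a3 v n ->
  runs env (IfLe a1 a2 a3 a4) v (n1 + n2 + n).+1.
Proof.
move=> [k1 e1 l1] [k2 e2 l2] le [k e l]; exists (k1 + k2 + k).+1.
  by apply: EvalIfLe e1 e2 _; rewrite le.
by rewrite ltnS !leq_add.
Qed.

Lemma runs_gt env a1 a2 a3 a4 x1 x2 v n1 n2 n : runs env a1 (VNum x1) n1 ->
  runs env a2 (VNum x2) n2 -> ~~ (x1 <= x2) -> runs env a4 v n ->
  runs env (IfLe a1 a2 a3 a4) v (n1 + n2 + n).+1.
Proof.
move=> [k1 e1 l1] [k2 e2 l2] le [k e l]; exists (k1 + k2 + k).+1.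
  by apply: EvalIfLe e1 e2 _; rewrite (negPf le).
by rewrite ltnS !leq_add.
Qed.

Lemma runs_case_nil env a a0 a1 v n1 n : runs env a VNil n1 -> runs env a0 v n ->
  runs env (Case a a0 a1) v (n1 + n).+1.
Proof.
move=> [k1 e1 l1] [k2 e2 l2]; exists (k1 + k2).+1; last by rewrite ltnS leq_add.
exact: EvalCaseNil e1 e2.
Qed.

Lemma runs_case_pair env a a0 a1 v1 v2 v n1 n : runs env a (VPair v1 v2) n1 ->
  runs (v1 :: v2 :: env) a1 v n -> runs env (Case a a0 a1) v (n1 + n).+1.
Proof.
move=> [k1 e1 l1] [k2 e2 l2]; exists (k1 + k2).+1; last by rewrite ltnS leq_add.
exact: EvalCasePair e1 e2.
Qed.

Lemma runs_call env f a v1 v n1 n : runs env a v1 n1 -> calls f v1 v n ->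
  runs env (Call f a) v (n1 + n).+1.
Proof.
move=> [k1 e1 l1] [body eb [k2 e2 l2]]; exists (k1 + k2).+1; last by rewrite ltnS leq_add.
exact: EvalCall e1 eb e2.
Qed.

End Runs.

(** Symbolic execution directed by syntax. A comparison is decided by a hypothesis in the context,
    which is why the specifications below first establish facts named [c]; calls are left as
    subgoals. *)
Ltac run_step :=
  lazymatch goal with
  | |- runs _ (Var _) _ _ => eapply runs_var; reflexivity
  | |- runs _ Zero _ _ => eapply runs_zero
  | |- runs _ One _ _ => eapply runs_one
  | |- runs _ MkNil _ _ => eapply runs_nil
  | |- runs _ (Arith Add _ _) _ _ => eapply runs_add
  | |- runs _ (Arith Defs.Sub _ _) _ _ => eapply runs_sub
  | |- runs _ (Arith Mul _ _) _ _ => eapply runs_mul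
  | |- runs _ (MkPair _ _) _ _ => eapply runs_pair
  | |- runs _ (Let _ _) _ _ => eapply runs_let
  | |- runs _ (Call _ _) _ _ => eapply runs_call
  | |- runs _ (IfLe _ _ _ _) _ _ =>
      first [ eapply runs_le; [run_step.. | eassumption | ]
            | eapply runs_gt; [run_step.. | eassumption | ] ]
  | |- runs _ (Case _ _ _) _ _ =>
      first [ eapply runs_case_pair; [eapply runs_var; reflexivity | ]
            | eapply runs_case_nil; [eapply runs_var; reflexivity | ] ]
  end.
Ltac run := repeat run_step.
Ltac start f := eapply (calls_body f); [reflexivity | unfold f; run | ].
Notation enc_nums := (enc_seq (@VNum _)).

(** * Correctness and cost of the individual functions *)

Section Specs.
Context {R : realType}.
Implicit Types (S T : seq R) (x y v w a h : R).

Lemma enc_pl_cons (p : piece R) s :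
  enc_pl (p :: s) = VPair (enc_piece p) (enc_pl s).
Proof. by []. Qed.

Lemma fill_spec x h k a S : h = x + k%:R ->
  calls 1 (VPair (VNum x) (VPair (VNum h) (VPair (VNum a) (enc_nums S))))
    (enc_nums (nseq k a ++ S)) (100 * k + 100).
Proof.
elim: k x => [|k IH] x hx.
  have c : ~~ (x + 1 <= h) by rewrite hx addr0; lra.
  by start f_fill.
have k0 : 0 <= k%:R :> R := ler0n _ _.
rewrite -natr1 in hx.
have c : x + 1 <= h by rewrite hx; lra.
start f_fill; first by apply: IH; rewrite hx; ring.
lia.
Qed.

Lemma expand_spec n s S : unit_chain n s S ->
  calls 2 (enc_pl s) (enc_nums S) (200 * (size s + size S) + 100).
Proof.
elim: s n S => [|p s IH] n S; first by move=> ->; start f_expand.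
case=> k [T [en eh -> ch]].
rewrite /enc_pl /= /enc_piece en eh.
start f_expand.
- exact: (IH _ _ ch).
- by apply: fill_spec; rewrite natrD.
- by rewrite size_cat size_nseq; lia.
Qed.

Definition form : Type := (R * R * seq R)%type.
Definition enc_form (f : form) : value R :=
  VPair (VNum f.1.1) (VPair (VNum f.1.2) (enc_nums f.2)).

Lemma parse_spec n p s S : unit_chain n (p :: s) S ->
  calls 3 (enc_pl (p :: s)) (enc_form (n%:R, slope p * n%:R + icpt p, S))
    (200 * (size (p :: s) + size S) + 200).
Proof.
move=> ch; have [k [T [en eh _ _]]] := ch.
have := expand_spec _ _ _ ch; rewrite /enc_pl /= /enc_piece en eh => spec.
start f_parse; first exact: spec.
lia.
Qed.

Lemma parse_all_spec (E : Type) (l : seq E) (m : E -> value R) (F : E -> form) (c : E -> nat) :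
  foldr (fun e P => calls 3 (m e) (enc_form (F e)) (c e) /\ P) True l ->
  calls 4 (enc_seq id (map m l)) (enc_seq enc_form (map F l))
    (sumn [seq c e + 100 | e <- l] + 100)%N.
Proof.
elim: l => [|e l IH] /=; first by move=> _; start f_parse_all.
case=> ce /IH {}IH; start f_parse_all; [exact: ce | exact: IH |]; lia.
Qed.

Lemma merge_spec S T :
  calls 5 (VPair (enc_nums S) (enc_nums T)) (enc_nums (merge <=%R S T))
    (100 * (size S + size T) + 100).
Proof.
elim: S T => [|s S IHS] T; first by start f_merge; lia.
elim: T => [|t T IHT]; first by start f_merge; lia.
rewrite merge_cons; case: ifPn => c.
  start f_merge; first exact: (IHS (t :: T)).
  by rewrite /=; lia.
start f_merge; first exact: IHT.
by rewrite /=; lia.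
Qed.

Definition convolve (f g : form) : form :=
  (f.1.1 + g.1.1, f.1.2 + g.1.2, merge <=%R f.2 g.2).

Lemma convolve_spec f g :
  calls 6 (VPair (enc_form f) (enc_form g)) (enc_form (convolve f g))
    (100 * (size f.2 + size g.2) + 200).
Proof. by start f_convolve; [exact: merge_spec | lia]. Qed.

Fixpoint pairs (fs : seq form) : seq form :=
  if fs is f :: g :: fs' then convolve f g :: pairs fs' else fs.

Definition slopes (fs : seq form) : seq R := flatten (map snd fs).

Lemma pairwise_ind (T : Type) (P : seq T -> Prop) :
  P [::] -> (forall t : T, P [:: t]) -> (forall (t u : T) s, P s -> P (t :: u :: s)) ->
  forall s, P s.
Proof.
move=> P0 P1 P2 s; suff [] : P s /\ forall t, P (t :: s) by [].
by elim: s => // t s [h1 h2]; split=> // u; apply: P2.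
Qed.

Lemma pairs_spec fs :
  calls 7 (enc_seq enc_form fs) (enc_seq enc_form (pairs fs))
    (300 * (size fs + size (slopes fs)) + 300).
Proof.
elim/pairwise_ind: fs => [|f|f g fs IH].
- by start f_pairs.
- by start f_pairs; rewrite /=; lia.
start f_pairs; [exact: convolve_spec | exact: IH |].
by rewrite /slopes /= !size_cat; lia.
Qed.

Lemma size_pairs fs : size (pairs fs) = uphalf (size fs).
Proof. by elim/pairwise_ind: fs => //= f g fs ->. Qed.

(** The invariants of a round. Total left end, total initial value and the multiset of slopes
    determine the final form, whatever the order of the merges. *)
Lemma pairs_sums fs :
  [/\ \sum_(f <- pairs fs) f.1.1 = \sum_(f <- fs) f.1.1,
      \sum_(f <- pairs fs) f.1.2 = \sum_(f <- fs) f.1.2,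
      perm_eq (slopes (pairs fs)) (slopes fs) &
      all (fun f => sorted <=%R f.2) fs -> all (fun f => sorted <=%R f.2) (pairs fs)].
Proof.
elim/pairwise_ind: fs => //= f g fs [h1 h2 h3 h4]; split.
- by rewrite !big_cons h1 addrA.
- by rewrite !big_cons h2 addrA.
- by rewrite /slopes /= catA perm_cat // perm_merge.
- move=> /and3P[sf sg /h4 ->]; rewrite andbT; exact: merge_sorted le_total _ _ sf sg.
Qed.

(** Each round halves the number of forms, rounded up, so [k] rounds suffice. The number of slopes
    does not change, so all rounds obey the same linear bound; the last factor also counts the final
    call on at most one form. *)
Lemma reduce_spec fs k : all (fun f => sorted <=%R f.2) fs -> (size fs <= 2 ^ k)%N ->
  exists f : form, [/\ calls 8 (enc_seq enc_form fs) (enc_form f)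
      (400 * (size fs + size (slopes fs) + 1) * k.+1),
    f.1.1 = \sum_(g <- fs) g.1.1, f.1.2 = \sum_(g <- fs) g.1.2,
    perm_eq f.2 (slopes fs) & sorted <=%R f.2].
Proof.
elim: k fs => [|k IH] fs.
  case: fs => [|f [|//]] /=.
    move=> _ _; exists (0, 0, [::]); rewrite !big_nil; split=> //.
    by start f_reduce.
  rewrite andbT => sf _; exists f; rewrite !big_seq1; split=> //.
    by start f_reduce; lia.
  by rewrite /slopes /= cats0.
case: fs => [|f [|g fs]] sfs szs.
- exists (0, 0, [::]); rewrite !big_nil; split=> //.
  by start f_reduce; lia.
- exists f; rewrite !big_seq1; split=> //.
  + by start f_reduce; lia.
  + by rewrite /slopes /= cats0.
  + by move: sfs; rewrite /= andbT.
have szp : (size (pairs (f :: g :: fs)) <= 2 ^ k)%N.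
  by rewrite size_pairs leq_uphalf_double -mul2n -expnS.
have [h1 h2 h3 h4] := pairs_sums (f :: g :: fs).
have [r [cr r1 r2 r3 r4]] := IH _ (h4 sfs) szp.
exists r; rewrite r1 r2 h1 h2; split=> //; last exact: perm_trans r3 h3.
start f_reduce.
- exact: (pairs_spec (f :: g :: fs)).
- exact: cr.
- rewrite (perm_size h3).
  have : (size (pairs (f :: g :: fs)) <= size (f :: g :: fs))%N.
    by rewrite size_pairs leq_uphalf_double -addnn leq_addr.
  move: (size (pairs _)) (size (slopes _)) (size (f :: _)) => A B C; nia.
Qed.

(** The cost is charged to the distance from [l] to [l'] travelled along the penalty, so that
    successive calls telescope. As breakpoints are natural numbers, a piece that contains [j] and
    ends after it also contains [j + 1]. *)
Lemma advance_spec (phi : R -> R) (l j : nat) s : load_chain phi l s -> (l <= j)%N ->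
  exists l' p s', [/\ calls 9 (VPair (VNum j%:R) (enc_pl s)) (enc_pl (p :: s'))
       (100 * (l' - l) + 100)%N,
     load_chain phi l' (p :: s'), (l <= l' <= j)%N,
     in_piece p j%:R & in_piece p j.+1%:R].
Proof.
elim: s l => // p s IH l ch lj; have [en val [eh|[m [lm eh ch']]]] := ch.
  exists l, p, s; split=> //.
  - by rewrite /enc_pl /= /enc_piece en eh; start f_advance; rewrite ?subnn.
  - by rewrite leqnn.
  - by rewrite /in_piece en eh leey andbT ler_nat.
  - by rewrite /in_piece en eh leey andbT ler_nat leqW.
case: (leqP m j) => mj.
  have [l' [q [s' [cq chq /andP[ml lj'] hq hq']]]] := IH m ch' mj.
  exists l', q, s'; split=> //; last by rewrite lj' andbT; lia.
  have c : m%:R <= j%:R :> R by rewrite ler_nat.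
  rewrite (enc_pl_cons p s) /enc_piece en eh; start f_advance; first exact: cq.
  lia.
have c : ~~ (m%:R <= j%:R :> R) by rewrite ler_nat -ltnNge.
exists l, p, s; split=> //.
- by rewrite /enc_pl /= /enc_piece en eh; start f_advance; rewrite ?subnn.
- by rewrite leqnn.
- by rewrite /in_piece en eh lee_fin !ler_nat lj ltnW.
- by rewrite /in_piece en eh lee_fin !ler_nat mj leqW.
Qed.

(** The second summand of the bound is the telescoped cost of the calls to [f_advance], which each
    resume where the previous one stopped. *)
Lemma load_spec (phi : R -> R) w (l j : nat) s S : load_chain phi l s -> (l <= j)%N ->
  calls 10 (VPair (VNum w) (VPair (VNum j%:R) (VPair (enc_nums S) (enc_pl s))))
    (enc_nums [seq p.1 + p.2 | p <-
       zip S [seq w * (phi k.+1%:R - phi k%:R) | k <- iota j (size S)]])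
    (300 * (size S + (j + size S - l)) + 100).
Proof.
elim: S l j s => [|a S IH] l j s ch lj; first by start f_load; lia.
have [l' [p [s' [cp chp /andP[ll lj'] pj pj']]]] := advance_spec _ _ _ _ ch lj.
have val : phi j.+1%:R - phi j%:R = slope p.
  have [_ v _] := chp; rewrite !v // -natr1; ring.
have spec := IH l' j.+1 (p :: s') chp ltac:(lia).
move: cp spec; rewrite /= val /enc_pl /= /enc_piece -natr1 => cp spec.
start f_load; [exact: cp | exact: spec |].
lia.
Qed.

Lemma reflect_spec S x v T :
  calls 11 (VPair (enc_nums S) (VPair (VNum x) (VPair (VNum v) (enc_nums T))))
    (enc_form (x - (size S)%:R, v + \sum_(s <- S) s, catrev (map -%R S) T))
    (100 * size S + 100).
Proof.
elim: S x v T => [|s S IH] x v T.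
  by rewrite big_nil subr0 addr0; start f_reflect.
rewrite /enc_form /= -natr1 sumr_cons.
have -> : x - ((size S)%:R + 1) = x - 1 - (size S)%:R by ring.
rewrite addrA -[- s]sub0r; start f_reflect; first exact: (IH (x - 1) (v + s) (0 - s :: T)).
lia.
Qed.

Definition enc_emit (u g x v : R) S :=
  VPair (VNum u) (VPair (VNum g) (VPair (VNum x) (VPair (VNum v) (enc_nums S)))).

Lemma emit_from_run u g x v S :
  calls 12 (enc_emit u g x v S) (enc_pl (emit_from u g x v S)) (200 * size S + 200).
Proof.
rewrite /enc_emit; elim: S x v => [|s S IH] x v; first by start f_emit_from.
rewrite /=; case: ifPn => c; last by start f_emit_from; lia.
start f_emit_from; first exact: IH.
lia.
Qed.

Lemma emit_run u g x v S :
  calls 13 (enc_emit u g x v S) (enc_pl (emit u g x v S)) (200 * size S + 400).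
Proof.
rewrite /enc_emit; elim: S x v => [|s S IH] x v.
  rewrite /=; case: ifPn => c; [case: ifPn => c'|]; start f_emit; lia.
rewrite /emit -/emit; case: ifPn => c; [case: ifPn => c'; [case: ifPn => c''|]|].
- by start f_emit; lia.
- by start f_emit; [exact: emit_from_run | rewrite /=; lia].
- by start f_emit; lia.
- by start f_emit; [exact: IH | rewrite /=; lia].
Qed.

End Specs.

(** * Correctness and cost of the complete update *)

Section Update.
Context {R : realType}.
Implicit Types (FA FB : seq (@form R)) (w u g : R).

(** The walk along the penalty begins at the integer [xA + a], whose size enters the cost because
    the pieces before it must be skipped. *)
Lemma update_spec (phi : R -> R) w u g (sload : seq (piece R)) (mA mB : value R)
    FA FB cA cB kA kB (xA a b : nat) :
  load_chain phi 0 sload ->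
  calls 4 mA (enc_seq enc_form FA) cA -> calls 4 mB (enc_seq enc_form FB) cB ->
  all (fun f => sorted <=%R f.2) FA -> all (fun f => sorted <=%R f.2) FB ->
  (size FA <= 2 ^ kA)%N -> (size FB <= 2 ^ kB)%N ->
  \sum_(f <- FA) f.1.1 = xA%:R ->
  exists SA SB : seq R,
    [/\ perm_eq SA (slopes FA), sorted <=%R SA, perm_eq SB (slopes FB), sorted <=%R SB &
    calls 14 (VPair mA (VPair (VNum a%:R) (VPair mB (VPair (VNum b%:R)
      (VPair (enc_pl sload) (VPair (VNum w) (VPair (VNum u) (VNum g))))))))
      (enc_pl (emit u g ((xA + a)%:R - b%:R - (\sum_(f <- FB) f.1.1 + (size SB)%:R))
        (\sum_(f <- FA) f.1.2 + w * phi (xA + a)%:R +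
          (\sum_(f <- FB) f.1.2 + \sum_(s <- SB) s))
        (merge <=%R
          (loaded_slopes (fun j => w * (phi j.+1%:R - phi j%:R)) xA SA a)
          (rev (map -%R SB)))))
      (cA + cB + 400 * (size FA + size SA + 1) * kA.+1 +
       400 * (size FB + size SB + 1) * kB.+1 +
       2000 * (size SA + size SB + (xA + a) + 1))].
Proof.
move=> ch cmA cmB sA sB kfA kfB xAE.
have [fA [cA' xfA vfA pA soA]] := reduce_spec _ _ sA kfA.
have [fB [cB' xfB vfB pB soB]] := reduce_spec _ _ sB kfB.
exists fA.2, fB.2; split => //.
have [l [p [s' [cad chp /andP[_ lx] pj pj']]]] := advance_spec _ _ (xA + a) _ ch (leq0n _).
have val : phi (xA + a)%:R = slope p * (xA + a)%:R + icpt p.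
  by have [_ v _] := chp; rewrite v.
have cload := load_spec _ w _ _ _ fA.2 chp lx.
have szL : size (loaded_slopes (fun j => w * (phi j.+1%:R - phi j%:R)) xA fA.2 a) = size fA.2.
  exact: size_loaded_slopes.
rewrite val -xfB -vfA -vfB.
rewrite (_ : (xA + a)%:R - b%:R - _ =
  (xA + a)%:R - b%:R + (0 - fB.1.1 - (size fB.2)%:R)); last by ring.
rewrite [in X in calls _ _ _ X](perm_size pA) [in X in calls _ _ _ X](perm_size pB).
rewrite /loaded_slopes in szL *.
move: (map _ (zip _ _)) szL cload => L szL cload.
move: cload cad; rewrite enc_pl_cons /enc_piece => cload cad.
rewrite natrD -xAE -xfA in cad cload val *.
start f_update.
- exact: cmA.
- exact: cA'.
- exact: cad.
- exact: cload.
- exact: cmB.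
- exact: cB'.
- exact: (reflect_spec fB.2 (0 - fB.1.1) fB.1.2 [::]).
- exact: (convolve_spec (_, _, L) (_, _, rev (map -%R fB.2))).
- exact: emit_run.
- rewrite /= size_merge size_cat szL size_rev size_map (perm_size pA) (perm_size pB).
  move: (400 * _ * kA.+1)%N (400 * _ * kB.+1)%N => X Y.
  move: (size (slopes FA)) (size (slopes FB)) => Z W.
  lia.
Qed.

Lemma main_in_spec w (r u : nat) c (ld ins outs out : value R) n :
  calls 14 (VPair outs (VPair (VNum 0) (VPair ins (VPair (VNum r%:R)
    (VPair ld (VPair (VNum w) (VPair (VNum u%:R) (VNum ((1 - w) * c)))))))))
    out n ->
  exists2 k, computes min_sum_program
    (enc_seq id [:: VNum w; VNum r%:R; VNum c; VNum u%:R; VNum 0; ld; ins; outs]) out k &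
   (k <= n + 100)%N.
Proof.
move=> spec; suff [k ev kn] : runs
   [:: enc_seq id [:: VNum w; VNum r%:R; VNum c; VNum u%:R; VNum 0; ld; ins; outs]]
   (Call 0 (Var 0)) out (n + 100)%N by exists k.
have c0 : (0 : R) <= 0 by [].
eapply runs_leq.
  run; start f_main; first exact: spec.
  exact: leqnn.
lia.
Qed.

Lemma main_out_spec w (r u : nat) c (ld ins outs out : value R) n :
  calls 14 (VPair ins (VPair (VNum r%:R) (VPair outs (VPair (VNum 0)
    (VPair ld (VPair (VNum w) (VPair (VNum u%:R) (VNum ((1 - w) * c)))))))))
    out n ->
  exists2 k, computes min_sum_program
    (enc_seq id [:: VNum w; VNum r%:R; VNum c; VNum u%:R; VNum 1; ld; ins; outs]) out k &
   (k <= n + 100)%N.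
Proof.
move=> spec; suff [k ev kn] : runs
   [:: enc_seq id [:: VNum w; VNum r%:R; VNum c; VNum u%:R; VNum 1; ld; ins; outs]]
   (Call 0 (Var 0)) out (n + 100)%N by exists k.
have c0 : ~~ ((1 : R) <= 0) by rewrite ler10.
eapply runs_leq.
  run; start f_main; first exact: spec.
  exact: leqnn.
lia.
Qed.

End Update.

(** * The update at a node *)

Section NodeUpdate.
Context {R : realType} (N : network R) (i : 'I_(nsrc N)) (e : edge N).
Notation ii := (inl i : node N).
Hypothesis e_inc : e \in inc_edges ii.
Variables (A B : seq (edge N)) (a b : nat).
Hypotheses (uniqA : uniq A) (uniqB : uniq B).
Hypothesis AB_disj : forall e', e' \in A -> e' \notin B.
Hypothesis inc_AB : forall e', e' \in inc_edges ii :\ e = (e' \in A) || (e' \in B).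
Hypothesis excess_AB : forall zt : edge N -> R, excess ii zt = (rate i)%:R <->
  zt e = \sum_(e' <- A) zt e' + a%:R - \sum_(e' <- B) zt e' - b%:R.
Hypothesis out_AB : forall zt : edge N -> R, excess ii zt = (rate i)%:R ->
  \sum_(e' in out_edges ii) zt e' = \sum_(e' <- A) zt e' + a%:R.

Variables (M : edge N -> R -> \bar R) (xs : edge N -> nat) (vs : edge N -> R)
  (Ss : edge N -> seq R).
Hypothesis sorted_Ss : forall e', e' \in inc_edges ii :\ e -> sorted <=%R (Ss e').
Hypothesis ME : forall e', e' \in inc_edges ii :\ e ->
  M e' = pl_form (xs e')%:R (vs e') (Ss e').

Let d j := weight N * (load i j.+1%:R - load i j%:R).
Let Q := step_form (fun x => weight N * load i x) d (\sum_(e' <- A) xs e')%N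
  (\sum_(e' <- A) vs e') (merges A Ss) a (\sum_(e' <- B) (xs e')%:R)
  (\sum_(e' <- B) vs e') (merges B Ss) b%:R.

Lemma weighted_load_linear (j : nat) (x : R) : j%:R <= x <= j%:R + 1 ->
  weight N * load i x = weight N * load i j%:R + d j * (x - j%:R).
Proof.
move=> jx; rewrite (penalty_linear (load i) _ (load_plc i) j x jx); last exact: load_incr.
rewrite /d; ring.
Qed.

Lemma weighted_load_increments j : d j <= d j.+1.
Proof.
apply: ler_wpM2l; first exact: ltW (weight_gt0 N).
exact: penalty_increments (load_plc i) j.
Qed.

(** Stated for a general commutative monoid since it serves both extended-real objective values and
    natural-number capacities. *)
Lemma big_inc (T : Type) (idx : T) (op : Monoid.com_law idx) (F : edge N -> T) :
  \big[op/idx]_(e' in inc_edges ii :\ e) F e' =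
  op (\big[op/idx]_(e' <- A) F e') (\big[op/idx]_(e' <- B) F e').
Proof.
rewrite !big_uniq // -bigU /=; last first.
  by rewrite disjoint_subset; apply/fintype.subsetP => e' /AB_disj; rewrite !inE.
by apply: eq_bigl => e'; rewrite inc_AB !inE.
Qed.

Lemma sum_incE (F : edge N -> \bar R) :
  (\sum_(e' in inc_edges ii :\ e) F e' =
   \sum_(e' <- A) F e' + \sum_(e' <- B) F e')%E.
Proof. exact: big_inc. Qed.

Let inA e' : e' \in A -> e' \in inc_edges ii :\ e.
Proof. by rewrite inc_AB => ->. Qed.
Let inB e' : e' \in B -> e' \in inc_edges ii :\ e.
Proof. by rewrite inc_AB orbC => ->. Qed.

Lemma sumM_A (zt : edge N -> R) : (\sum_(e' <- A) M e' (zt e') =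
  \sum_(e' <- A) pl_form (xs e')%:R (vs e') (Ss e') (zt e'))%E.
Proof. by apply: eq_big_seq => e' /inA /ME ->. Qed.

Lemma sumM_B (zt : edge N -> R) : (\sum_(e' <- B) M e' (zt e') =
  \sum_(e' <- B) pl_form (xs e')%:R (vs e') (Ss e') (zt e'))%E.
Proof. by apply: eq_big_seq => e' /inB /ME ->. Qed.

Lemma update_value_ge (zt : edge N -> R) :
  (Q (zt e) <= node_fun i zt + \sum_(e' in inc_edges ii :\ e) M e' (zt e'))%E.
Proof.
rewrite /node_fun; case: eqVneq => [ex|_]; last first.
  (* If conservation fails the value is infinite, provided that the sum of the messages is not minus
     infinity. *)
  rewrite addye ?leey //.
  apply/eqP => /eqP; rewrite esum_eqNy => /existsP[e' /andP[he']].
  by rewrite ME // => /eqP h; have := pl_form_gtNoo (xs e')%:R (vs e') (Ss e') (zt e'); rewrite h.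
have -> : zt e = \sum_(e' <- A) zt e' + a%:R - \sum_(e' <- B) zt e' - b%:R.
  exact/excess_AB.
rewrite sum_incE sumM_A sumM_B out_AB // add0e.
apply: le_trans (step_form_le _ _ _ _ _ _ _ _ _ _ _ _ _ _ _ _) _.
- exact: weighted_load_linear.
- exact: weighted_load_increments.
- by apply: sorted_merges => e' /inA/sorted_Ss.
- by apply: sorted_merges => e' /inB/sorted_Ss.
rewrite [leRHS]addeC; apply: leeD => //; rewrite natr_sum; apply: leeD.
  by apply: pl_form_merges_le => e' /inA/sorted_Ss.
by apply: pl_form_merges_le => e' /inB/sorted_Ss.
Qed.

Lemma update_is_min z : 0 <= z -> is_min (update_values i M e z) (Q z).
Proof.
move=> z0; split; last first.
  by move=> _ [zt [_ <-] <-]; exact: update_value_ge.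
have [Qz|] := boolP (Q z < +oo)%E; last first.
  rewrite -leNgt leye_eq => /eqP Qoo.
  (* All candidates have infinite value, but the minimum must still be attained by one of them; any
     nonnegative vector with value [z] at [e] will do. *)
  exists (fun e' => if e' == e then z else 0).
    by split=> [e' _|]; rewrite ?eqxx //; case: ifP.
  have := update_value_ge (fun e' => if e' == e then z else 0).
  by rewrite eqxx Qoo leye_eq => /eqP.
have := step_form_split _ _ weighted_load_linear _ _ _ _ _ _ _ _ _ Qz.
move=> [p [q [zE hp hq QE]]].
rewrite natr_sum in hp QE.
have [ztA [sA finA eA]] := pl_form_merges_split _ _ _ _ _ uniqA hp.
have [ztB [sB finB eB]] := pl_form_merges_split _ _ _ _ _ uniqB hq.
have eNA : e \notin A by apply/negP => /inA; rewrite !inE eqxx.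
have eNB : e \notin B by apply/negP => /inB; rewrite !inE eqxx.
pose zt e' := if e' \in A then ztA e' else if e' \in B then ztB e' else z.
have ztAE e' : e' \in A -> zt e' = ztA e' by rewrite /zt => ->.
have ztBE e' : e' \in B -> zt e' = ztB e'.
  by move=> eB'; rewrite /zt eB'; case: ifP => // /AB_disj; rewrite eB'.
have zte : zt e = z by rewrite /zt (negPf eNA) (negPf eNB).
have SA : \sum_(e' <- A) zt e' = p by rewrite -sA; apply: eq_big_seq.
have SB : \sum_(e' <- B) zt e' = q by rewrite -sB; apply: eq_big_seq.
have ex : excess ii zt = (rate i)%:R by apply/excess_AB; rewrite SA SB zte.
exists zt.
  (* Nonnegativity comes for free: a finite message value forces [zt e'] to be at least the left end
     [xs e'], a natural number. *)
  split=> // e' he'; have [->|ne] := eqVneq e' e; first by rewrite zte.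
  have : e' \in inc_edges ii :\ e by rewrite !inE ne; rewrite !inE in he'.
  have x0 : 0 <= (xs e')%:R :> R := ler0n _ _.
  rewrite inc_AB => /orP[h|h].
    by rewrite ztAE //; have := finA e' h; rewrite pl_form_ltoo; lra.
  by rewrite ztBE //; have := finB e' h; rewrite pl_form_ltoo; lra.
rewrite /node_fun ex eqxx add0e sum_incE sumM_A sumM_B out_AB // SA /Q QE eA eB addeC.
congr (_ + _)%E; congr (_ + _)%E.
  by apply: eq_big_seq => e' h; rewrite ztAE.
by apply: eq_big_seq => e' h; rewrite ztBE.
Qed.

Variable smsg : edge N -> seq (piece R).
Hypothesis parse_msg : forall e', e' \in inc_edges ii :\ e ->
  calls 3 (enc_pl (smsg e')) (enc_form ((xs e')%:R, vs e', Ss e')) (1000 * cap e').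
Hypothesis xs_cap : forall e', e' \in inc_edges ii :\ e ->
  (xs e' + size (Ss e') <= cap e')%N.
Variables tA tB : nat.
Hypotheses (size_A : (size A <= 2 ^ tA.+1)%N) (size_B : (size B <= 2 ^ tB.+1)%N).
Hypothesis a_cap : (a <= total_cap ii)%N.

Let F e' : form := ((xs e')%:R, vs e', Ss e').

Lemma enc_seq_map (T U : Type) (enc : U -> value R) (f : T -> U) (l : seq T) :
  enc_seq enc (map f l) = enc_seq id (map (fun t => enc (f t)) l).
Proof. by rewrite /enc_seq !foldr_map. Qed.

Lemma parse_messages l : {subset l <= inc_edges ii :\ e} ->
  calls 4 (enc_seq (@enc_pl R) (map smsg l)) (enc_seq enc_form (map F l))
    (1100 * (\sum_(e' <- l) cap e') + 100).
Proof.
move=> sub; rewrite enc_seq_map.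
apply: calls_leq (parse_all_spec _ _ _ _ (fun e' => 1000 * cap e')%N _) _.
  elim: l sub => //= e' l IH sub; split.
    by apply: parse_msg; apply: sub; exact: mem_head.
  by apply: IH => t tl; apply: sub; rewrite inE tl orbT.
rewrite leq_add2r; elim: l sub => [|e' l IH] sub; first by rewrite big_nil.
have : (0 < cap e')%N.
  have := sub e' (mem_head _ _); rewrite !inE => /andP[_ /orP[]] /andP[h _]; exact: cap_gt0.
have := IH (fun t tl => sub t (mem_behead (s := e' :: l) tl)).
rewrite /= big_cons; lia.
Qed.

(** Reconciles the merging in rounds with [merges]: a sorted list is determined by its multiset. *)
Lemma perm_merges_eq S l : perm_eq S (slopes (map F l)) -> sorted <=%R S ->
  {subset l <= inc_edges ii :\ e} -> S = merges l Ss.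
Proof.
move=> pS sS sub; apply: (sorted_eq le_trans le_anti) => //.
  by apply: sorted_merges => e' /sub/sorted_Ss.
rewrite (perm_trans pS) // perm_sym (perm_trans (perm_merges _ _)) //.
by rewrite /slopes -map_comp.
Qed.

(** The first inequality is strict because the positive capacity of [e] is missing on the left. The
    sizes of [A] and [B] are bounded since every edge has capacity at least 1. *)
Lemma cap_sums : [/\ (\sum_(e' <- A) cap e' + \sum_(e' <- B) cap e' < total_cap ii)%N,
  (\sum_(e' <- A) xs e' + size (merges A Ss) <= \sum_(e' <- A) cap e')%N,
  (size (merges B Ss) <= \sum_(e' <- B) cap e')%N,
  (size A <= \sum_(e' <- A) cap e')%N & (size B <= \sum_(e' <- B) cap e')%N].
Proof.
have cap0 e' : e' \in inc_edges ii -> (0 < cap e')%N.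
  by rewrite !inE => /orP[]/andP[h _]; exact: cap_gt0.
have capD e' : e' \in inc_edges ii :\ e -> (0 < cap e')%N.
  by rewrite inE => /andP[_ /cap0].
have szm l : {subset l <= inc_edges ii :\ e} ->
    (\sum_(e' <- l) xs e' + size (merges l Ss) <= \sum_(e' <- l) cap e')%N /\
    (size l <= \sum_(e' <- l) cap e')%N.
  elim: l => [|e' l IH] sub; first by rewrite !big_nil.
  have [] := IH (fun t tl => sub t (mem_behead (s := e' :: l) tl)).
  have := capD _ (sub e' (mem_head _ _)); have := xs_cap _ (sub e' (mem_head _ _)).
  by rewrite !big_cons /= size_merge size_cat; lia.
have [h1 h2] := szm A inA; have [h3 h4] := szm B inB.
split=> //; last exact: leq_trans (leq_addl _ _) h3.
rewrite /total_cap (big_setD1 e) // (big_inc _ _ addn) /=.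
by rewrite -[X in (X < _)%N]add0n ltn_add2r cap0.
Qed.

(** Kept as an integer: the left end may be negative before clipping, and its integrality is what
    keeps the breakpoints integral. *)
Definition update_shift : int :=
  (\sum_(e' <- A) xs e' + a)%N%:Z - b%:Z -
  (\sum_(e' <- B) xs e' + size (merges B Ss))%N%:Z.
Definition update_start : R :=
  \sum_(e' <- A) vs e' + weight N * load i (\sum_(e' <- A) xs e' + a)%N%:R +
  (\sum_(e' <- B) vs e' + \sum_(s <- merges B Ss) s).
Definition update_slopes : seq R :=
  merge <=%R (loaded_slopes d (\sum_(e' <- A) xs e')%N (merges A Ss) a)
    (rev (map -%R (merges B Ss))).

Lemma sorted_update_slopes : sorted <=%R update_slopes.
Proof.
apply: sorted_step; first exact: weighted_load_increments.
- by apply: sorted_merges => e' /inA/sorted_Ss.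
- by apply: sorted_merges => e' /inB/sorted_Ss.
Qed.

Lemma update_shiftE : update_shift%:~R = (\sum_(e' <- A) xs e' + a)%N%:R - b%:R -
  (\sum_(e' <- B) (xs e')%:R + (size (merges B Ss))%:R) :> R.
Proof. by rewrite /update_shift !rmorphB /= -!pmulrn [X in _ - X]natrD natr_sum. Qed.

Lemma update_is_min_form z : 0 <= z ->
  is_min (update_values i M e z) (pl_form update_shift%:~R update_start update_slopes z).
Proof. by move=> /update_is_min; rewrite /Q /step_form update_shiftE. Qed.

Lemma update_run (sload : seq (piece R)) (u g : R) :
  represents sload [set x | x \is a Num.int] (extend_nneg (load i)) ->
  calls 14 (VPair (enc_seq (@enc_pl R) (map smsg A)) (VPair (VNum a%:R)
     (VPair (enc_seq (@enc_pl R) (map smsg B)) (VPair (VNum b%:R)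
      (VPair (enc_pl sload) (VPair (VNum (weight N)) (VPair (VNum u) (VNum g))))))))
    (enc_pl (emit u g update_shift%:~R update_start update_slopes))
    (100 * (130 * total_cap ii * (1 + tA + tB))).
Proof.
move=> /represents_load_chain ch.
have srt l : {subset l <= inc_edges ii :\ e} ->
    all (fun f : form => sorted <=%R f.2) (map F l).
  by move=> sub; apply/allP => f /mapP[e' /sub/sorted_Ss h ->].
have xE : \sum_(f <- map F A) f.1.1 = (\sum_(e' <- A) xs e')%N%:R.
  by rewrite big_map natr_sum.
have szA : (size (map F A) <= 2 ^ tA.+1)%N by rewrite size_map.
have szB : (size (map F B) <= 2 ^ tB.+1)%N by rewrite size_map.
have := update_spec _ (weight N) u g _ _ _ _ _ _ _ _ _ _ a b ch
  (parse_messages A inA) (parse_messages B inB) (srt A inA) (srt B inB) szA szB xE.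
move=> [SA [SB [pA sA pB sB]]].
rewrite (perm_merges_eq SA A pA sA inA) (perm_merges_eq SB B pB sB inB) !big_map !size_map.
rewrite -update_shiftE => run; apply: calls_leq run _.
have [h1 h2 h3 h4 h5] := cap_sums.
have h6 := a_cap; set T := total_cap _ in h1 h6 *.
move: h1 h2 h3 h4 h5 h6.
move: (size (merges A _)) (size (merges B _)) (\sum_(e' <- A) xs e')%N
  (\sum_(e' <- A) cap e')%N (\sum_(e' <- B) cap e')%N (size A) (size B) T
  => mA mB xA cA cB nA nB T h1 h2 h3 h4 h5 h6.
(* At most [2 ^ tA.+1] messages take [tA + 1] rounds, and the final call gives [tA.+2]. The products
   with [T] are then generalized to make the remaining inequality linear. *)
have hA : ((nA + mA + 1) * tA.+2 <= 2 * T * tA.+2)%N by apply: leq_mul => //; lia.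
have hB : ((nB + mB + 1) * tB.+2 <= 2 * T * tB.+2)%N by apply: leq_mul => //; lia.
have eA : (2 * T * tA.+2 = 2 * (T * tA) + 4 * T)%N by ring.
have eB : (2 * T * tB.+2 = 2 * (T * tB) + 4 * T)%N by ring.
have eT : (130 * T * (1 + tA + tB) = 130 * (T + T * tA + T * tB))%N by ring.
rewrite eT -!(mulnA 400%N); rewrite eA in hA; rewrite eB in hB.
move: hA hB.
move: (_ * tA.+2)%N (_ * tB.+2)%N (T * tA)%N (T * tB)%N => W X Y Z hA hB.
clear -h1 h2 h3 h4 h5 h6 hA hB; lia.
Qed.

End NodeUpdate.

(** * The two orientations of the edge at a source *)

Section NodeStep.
Context {R : realType} (N : network R).
Implicit Types (e : edge N).
Variables (x0 : edge N -> R) (i : 'I_(nsrc N)).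
Hypothesis feas : feasible_flow x0.
Notation ii := (inl i : node N).

Lemma inc_edges_sub (k : node N) e : e \in inc_edges k -> e \in edges N.
Proof. by rewrite !inE => /orP[]/andP[]. Qed.

Lemma out_not_in (k : node N) e : e \in out_edges k -> e \notin in_edges k.
Proof.
rewrite !inE => /andP[he /eqP e1]; apply/negP => /andP[_ /eqP e2].
by have := edges_irrefl he; rewrite e1 e2 eqxx.
Qed.

(** In a feasible flow at least the rate leaves the node. This bounds the distance [a] by which the
    penalty is shifted, and so the time for skipping its initial pieces. *)
Lemma rate_le_total_cap : (rate i <= total_cap ii)%N.
Proof.
have [fl bd] := feas; rewrite -(ler_nat R) -fl /excess /total_cap natr_sum.
apply: (@le_trans _ _ (\sum_(e in out_edges ii) x0 e)).
  rewrite lerBlDr lerDl sumr_ge0 // => e; rewrite inE => /andP[/bd/andP[]//].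
apply: (@le_trans _ _ (\sum_(e in out_edges ii) (cap e)%:R)).
  by apply: ler_sum => e; rewrite inE => /andP[/bd/andP[]//].
rewrite [leRHS](bigID (fun e => e \in out_edges ii)) /=.
rewrite [X in _ <= X + _](eq_bigl (fun e => e \in out_edges ii)).
  by rewrite lerDl sumr_ge0.
by move=> e; rewrite inE; case: (e \in out_edges ii); rewrite ?andbF.
Qed.

Lemma sum_del (X : {set edge N}) e (F : edge N -> R) :
  \sum_(e' in X) F e' =
  (if e \in X then F e else 0) + \sum_(e' <- enum (X :\ e)) F e'.
Proof.
rewrite big_enum /=; case: ifPn => eX; first by rewrite (big_setD1 e).
rewrite add0r; apply: eq_bigl => e'; rewrite !inE.
by case: eqVneq => // ->; rewrite (negPf eX).
Qed.

Lemma size_enum_del (X : {set edge N}) e :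
  (size (enum (X :\ e)) <= 2 ^ (trunc_log 2 #|X|).+1)%N.
Proof.
rewrite -cardE; apply: leq_trans (subset_leq_card (subD1set X e)) _.
exact: ltnW (trunc_log_ltn _ _).
Qed.

Variables (e : edge N) (M : edge N -> R -> \bar R) (smsg : edge N -> seq (piece R)).
Hypothesis e_inc : e \in inc_edges ii.
Hypothesis smsgP : forall e', e' \in inc_edges ii :\ e ->
  [/\ represents (smsg e') (nat_upto (cap e')) (M e'), convex_efun (M e'),
      forall z, (M e' z < +oo)%E -> z <= (cap e')%:R & smsg e' != [::]].

Lemma parsed_forms : exists F : edge N -> nat * R * seq R,
  forall e', e' \in inc_edges ii :\ e ->
  [/\ sorted <=%R (F e').2, M e' = pl_form (F e').1.1%:R (F e').1.2 (F e').2,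
    calls 3 (enc_pl (smsg e')) (enc_form ((F e').1.1%:R, (F e').1.2, (F e').2))
      (1000 * cap e') & ((F e').1.1 + size (F e').2 <= cap e')%N].
Proof.
suff /choice[F hF] : forall e', exists f : nat * R * seq R, e' \in inc_edges ii :\ e ->
  [/\ sorted <=%R f.2, M e' = pl_form f.1.1%:R f.1.2 f.2,
    calls 3 (enc_pl (smsg e')) (enc_form (f.1.1%:R, f.1.2, f.2))
      (1000 * cap e') & (f.1.1 + size f.2 <= cap e')%N] by exists F.
move=> e'; have [he'|] := boolP (e' \in inc_edges ii :\ e); last by exists (0%N, 0, [::]).
have [rep cv bd nil] := smsgP e' he'.
have [n [S [p [s' [es ch en [nS sz] [sS ME]]]]]] := represents_pl_form _ _ _ rep cv bd nil.
exists (n, slope p * n%:R + icpt p, S) => _; split=> //=.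
(* Positive capacity absorbs the additive constants of the parsing cost. *)
have c0 : (0 < cap e')%N.
  by apply: cap_gt0; move: he'; rewrite inE => /andP[_ /inc_edges_sub].
rewrite es in ch sz *; apply: calls_leq (parse_spec _ _ _ _ ch) _.
move: sz; rewrite /=; lia.
Qed.

Lemma node_step : exists (j : int) (v : R) (S : seq R),
  [/\ sorted <=%R S,
    forall z, 0 <= z -> is_min (update_values i M e z) (pl_form j%:~R v S z) &
    forall sload, represents sload [set x | x \is a Num.int] (extend_nneg (load i)) ->
      exists2 k, computes min_sum_program (update_input i e sload smsg)
        (enc_pl (emit (cap e)%:R ((1 - weight N) * cost e) j%:~R v S)) k &
        (k <= 200 * 130 * total_cap ii *
          (1 + trunc_log 2 #|in_edges ii| + trunc_log 2 #|out_edges ii|))%N].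
Proof.
have [F hF] := parsed_forms.
pose xs e' := (F e').1.1; pose vs e' := (F e').1.2; pose Ss e' := (F e').2.
have hsort e' (h : e' \in inc_edges ii :\ e) : sorted <=%R (Ss e') by have [] := hF e' h.
have hME e' (h : e' \in inc_edges ii :\ e) : M e' = pl_form (xs e')%:R (vs e') (Ss e').
  by have [] := hF e' h.
have hcall e' (h : e' \in inc_edges ii :\ e) : calls 3 (enc_pl (smsg e'))
  (enc_form ((xs e')%:R, vs e', Ss e')) (1000 * cap e') by have [] := hF e' h.
have hcap e' (h : e' \in inc_edges ii :\ e) : (xs e' + size (Ss e') <= cap e')%N.
  by have [] := hF e' h.
pose I := enum (in_edges ii :\ e); pose O := enum (out_edges ii :\ e).
have inIO e' : e' \in inc_edges ii :\ e = (e' \in I) || (e' \in O).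
  by rewrite !mem_enum !inE; case: (e' == e); case: (e' \in edges N); rewrite //= orbC.
have disjIO e' : e' \in I -> e' \notin O.
  rewrite !mem_enum inE => /andP[_ h]; rewrite inE negb_and; apply/orP; right.
  by apply: contraL h; exact: out_not_in.
(* Positivity lets a doubled leading constant absorb the fixed overhead of [f_main]. *)
have total_gt0 : (0 < total_cap ii)%N.
  by rewrite /total_cap (big_setD1 e) //= addn_gt0 cap_gt0 // (inc_edges_sub ii).
set tI := trunc_log 2 #|in_edges ii|; set tO := trunc_log 2 #|out_edges ii|.
have [eout|eout] := boolP (e \in out_edges ii).
  have sumO (zt : edge N -> R) : \sum_(e' in out_edges ii) zt e' = zt e + \sum_(e' <- O) zt e'.
    by rewrite (sum_del _ e) eout.
  have sumI (zt : edge N -> R) : \sum_(e' in in_edges ii) zt e' = \sum_(e' <- I) zt e'.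
    by rewrite (sum_del _ e) (negPf (out_not_in _ _ eout)) add0r.
  have ex (zt : edge N -> R) : excess ii zt = (rate i)%:R <->
      zt e = \sum_(e' <- I) zt e' + (rate i)%:R - \sum_(e' <- O) zt e' - 0%:R.
    by rewrite /excess sumO sumI; split=> h; lra.
  have ou (zt : edge N -> R) : excess ii zt = (rate i)%:R ->
      \sum_(e' in out_edges ii) zt e' = \sum_(e' <- I) zt e' + (rate i)%:R.
    by rewrite /excess sumI => h; lra.
  exists (update_shift N I O (rate i) 0 xs Ss), (update_start N i I O (rate i) xs vs Ss),
    (update_slopes N i I O (rate i) xs Ss); split.
  - by apply: (sorted_update_slopes N i e).
  - by apply: update_is_min_form => //; exact: enum_uniq.
  - move=> sload rep.
    have run := update_run N i e e_inc I O (rate i) 0 (enum_uniq _) (enum_uniq _) disjIO inIO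
      xs vs Ss hsort smsg hcall hcap tI tO (size_enum_del _ _) (size_enum_del _ _)
      rate_le_total_cap sload (cap e)%:R ((1 - weight N) * cost e) rep.
    have [k ck kn] := main_out_spec _ _ _ _ _ _ _ _ _ run.
    by exists k; [rewrite /update_input eout; exact: ck | nia].
have ein : e \in in_edges ii by move: e_inc; rewrite inE (negPf eout).
have sumO (zt : edge N -> R) : \sum_(e' in out_edges ii) zt e' = \sum_(e' <- O) zt e'.
  by rewrite (sum_del _ e) (negPf eout) add0r.
have sumI (zt : edge N -> R) : \sum_(e' in in_edges ii) zt e' = zt e + \sum_(e' <- I) zt e'.
  by rewrite (sum_del _ e) ein.
have inOI e' : e' \in inc_edges ii :\ e = (e' \in O) || (e' \in I) by rewrite orbC.
have disjOI e' : e' \in O -> e' \notin I by apply: contraL; exact: disjIO.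
have ex (zt : edge N -> R) : excess ii zt = (rate i)%:R <->
    zt e = \sum_(e' <- O) zt e' + 0%:R - \sum_(e' <- I) zt e' - (rate i)%:R.
  by rewrite /excess sumO sumI; split=> h; lra.
have ou (zt : edge N -> R) : excess ii zt = (rate i)%:R ->
    \sum_(e' in out_edges ii) zt e' = \sum_(e' <- O) zt e' + 0%:R.
  by rewrite sumO addr0.
exists (update_shift N O I 0 (rate i) xs Ss), (update_start N i O I 0 xs vs Ss),
  (update_slopes N i O I 0 xs Ss); split.
- by apply: (sorted_update_slopes N i e).
- by apply: update_is_min_form => //; exact: enum_uniq.
- move=> sload rep.
  have run := update_run N i e e_inc O I 0 (rate i) (enum_uniq _) (enum_uniq _) disjOI inOI
    xs vs Ss hsort smsg hcall hcap tO tI (size_enum_del _ _) (size_enum_del _ _)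
    (leq0n _) sload (cap e)%:R ((1 - weight N) * cost e) rep.
  have [k ck kn] := main_in_spec _ _ _ _ _ _ _ _ _ run.
  by exists k; [rewrite /update_input (negPf eout); exact: ck | nia].
Qed.

End NodeStep.

(** * Messages *)

Section Messages.
Context {R : realType} (N : network R) (x0 : edge N -> R).
Hypothesis feas : feasible_flow x0.
Implicit Types (e : edge N) (k : node N).

Lemma convex_efun_add (f g : R -> \bar R) :
  (forall z, (-oo < f z)%E) -> (forall z, (-oo < g z)%E) ->
  convex_efun f -> convex_efun g -> convex_efun (fun z => (f z + g z)%E).
Proof.
move=> f0 g0 cf cg x y s s01; apply: le_trans (leeD (cf x y s s01) (cg x y s s01)) _.
have def z : (f z +? g z)%E by rewrite ltninfty_adde_def // inE.
by rewrite !muleDr // addeACA.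
Qed.

Lemma edge_fun_form e :
  edge_fun e = pl_form 0 0 (nseq (cap e) ((1 - weight N) * cost e)).
Proof.
apply/funext => z; rewrite /edge_fun /pl_form size_nseq add0r subr0.
by case: ifP => // h; rewrite add0r -[nseq _ _]cats0 slope_sum_nseq_le.
Qed.

Lemma edge_fun_convex e : convex_efun (edge_fun e).
Proof.
rewrite edge_fun_form; apply: pl_form_convex.
by case: (cap e) => //= n; elim: n => //= n ->; rewrite lexx.
Qed.

Lemma edge_fun_represents e : e \in edges N ->
  represents [:: ((0, (cap e)%:R%:E), ((1 - weight N) * cost e, 0))]
    (nat_upto (cap e)) (edge_fun e).
Proof.
move=> he; split.
- by split=> //; left; rewrite /= andbT lte_fin ltr0n; exact: cap_gt0.
- move=> p; rewrite inE => /eqP ->; split; first by exists 0%N.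
  by move=> r [<-]; exists (cap e).
- move=> p z; rewrite inE => /eqP ->; rewrite /in_piece /lo /hi /= lee_fin => h.
  by rewrite /edge_fun h /slope /icpt /= addr0.
- by move=> z; rewrite /= orbF /in_piece /lo /hi /= lee_fin /edge_fun => /negPf ->.
Qed.

Lemma other_end_inc k e : e \in inc_edges k -> e \in inc_edges (other_end k e).
Proof.
by rewrite /other_end !inE; case: eqVneq => [->|_]; rewrite ?eqxx ?orbT ?andbT ?andbF //= ?orbb;
  case: (e \in edges N); rewrite //= ?eqxx ?orbT.
Qed.

(** The feasible flow is admissible in every update, so by induction each message is finite on it.
    Thus no representation of a message is empty, as [f_parse] presupposes. *)
Lemma message_lty t k e : e \in edges N -> (message t k e (x0 e) < +oo)%E.
Proof.
have [fl bd] := feas.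
have fin e' : e' \in edges N -> (edge_fun e' (x0 e') < +oo)%E.
  by move=> he; rewrite /edge_fun bd // ltry.
elim: t k e => [|t IH] [i|j] e he /=; [exact: fin .. | | exact: fin].
apply: lte_add_pinfty; first exact: fin.
apply: le_lt_trans (ereal_inf_lbound _) _.
  exists x0 => //; split=> // e' he'.
  by have /inc_edges_sub/bd/andP[] := he'.
rewrite /node_fun fl eqxx add0e; apply: lte_add_pinfty; first exact: ltry.
apply: lte_sum_pinfty => e'; rewrite inE => /andP[_ /inc_edges_sub].
exact: IH.
Qed.

(** The induction invariant for messages. The bound on the domain is listed separately because
    [represents] admits an unbounded last piece. *)
Definition tame_message t k e := exists s,
  [/\ represents s (nat_upto (cap e)) (message t k e), convex_efun (message t k e) &
      forall z, (message t k e z < +oo)%E -> z <= (cap e)%:R].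

Lemma edge_fun_ltoo e z : (edge_fun e z < +oo)%E -> z <= (cap e)%:R.
Proof. by rewrite /edge_fun; case: ifP => // /andP[]. Qed.

Lemma message_step t (i : 'I_(nsrc N)) e
    (M := fun e' => message t (other_end (inl i : node N) e') e') :
  e \in inc_edges (inl i : node N) ->
  (forall e', e' \in inc_edges (inl i : node N) :\ e ->
    tame_message t (other_end (inl i : node N) e') e') ->
  forall smsg : edge N -> seq (piece R),
  (forall e', e' \in inc_edges (inl i : node N) :\ e ->
     represents (smsg e') (nat_upto (cap e')) (M e')) ->
  exists (j : int) (v : R) (S : seq R),
  [/\ sorted <=%R S,
    message t.+1 (inl i) e =
      clipped (cap e)%:R ((1 - weight N) * cost e) j%:~R v S,
    forall z, 0 <= z -> exists y, is_min (update_values i M e z) y /\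
        message t.+1 (inl i) e z = (edge_fun e z + y)%E &
    forall sload, represents sload [set x | x \is a Num.int] (extend_nneg (load i)) ->
      exists2 k, computes min_sum_program (update_input i e sload smsg)
        (enc_pl (emit (cap e)%:R ((1 - weight N) * cost e) j%:~R v S)) k &
        (k <= 200 * 130 * total_cap (inl i : node N) *
          (1 + trunc_log 2 #|in_edges (inl i : node N)| +
               trunc_log 2 #|out_edges (inl i : node N)|))%N].
Proof.
move=> he tame smsg rep.
have smsgP e' : e' \in inc_edges (inl i : node N) :\ e ->
    [/\ represents (smsg e') (nat_upto (cap e')) (M e'), convex_efun (M e'),
      forall z, (M e' z < +oo)%E -> z <= (cap e')%:R & smsg e' != [::]].
  move=> he'; have [s [_ cv bd]] := tame e' he'; split=> //; first exact: rep.
  have ee' : e' \in edges N by move: he'; rewrite inE => /andP[_ /inc_edges_sub].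
  have := message_lty t (other_end (inl i : node N) e') e' ee'.
  by rewrite (represents_ltoo _ _ _ _ (rep e' he')); case: (smsg e').
have [j [v [S [sS mn run]]]] := node_step N x0 i feas e M smsg he smsgP.
have inf z : 0 <= z -> ereal_inf (update_values i M e z) = pl_form j%:~R v S z.
  move=> z0; have [y lb] := mn z z0; apply/eqP; rewrite eq_le; apply/andP; split.
    exact: ereal_inf_lbound.
  exact: le_ereal_inf_tmp.
exists j, v, S; split=> //.
- apply/funext => z; rewrite /= -/M /clipped /edge_fun.
  case: ifPn => [/andP[z0 _]|_]; first by rewrite inf.
  have [z0|z0] := leP 0 z; first by rewrite inf.
  (* For negative [z] no vector is admissible; the infimum over the empty set is infinite, in
     agreement with the edge function. *)
  rewrite (_ : update_values i M e z = set0) ?ereal_inf0; last first.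
    apply/seteqP; split => // y [zt [zt0 ze] _]; have := zt0 e he.
    by rewrite ze leNgt z0.
  rewrite !addye //; have := pl_form_gtNoo j%:~R v S z.
  by case: (pl_form _ _ _ _).
- move=> z z0; exists (pl_form j%:~R v S z); split; first exact: mn.
  by rewrite /= -/M inf.
Qed.

Lemma message_tame t k e : e \in inc_edges k -> tame_message t k e.
Proof.
elim: t k e => [|t IH] k e he.
  exists [:: ((0, (cap e)%:R%:E), ((1 - weight N) * cost e, 0))].
  split; [by apply: edge_fun_represents; move/inc_edges_sub: he
    | exact: edge_fun_convex | exact: edge_fun_ltoo].
case: k he => [i|j] he; last first.
  exists [:: ((0, (cap e)%:R%:E), ((1 - weight N) * cost e, 0))].
  split; [by apply: edge_fun_represents; move/inc_edges_sub: he
    | exact: edge_fun_convex | exact: edge_fun_ltoo].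
have tame e' : e' \in inc_edges (inl i : node N) :\ e ->
    tame_message t (other_end (inl i : node N) e') e'.
  by rewrite inE => /andP[_ he']; apply: IH; exact: other_end_inc.
(* The empty list is a dummy value for edges that do not take part in the update. *)
have /choice[smsg rep] : forall e', exists s, e' \in inc_edges (inl i : node N) :\ e ->
    represents s (nat_upto (cap e')) (message t (other_end (inl i : node N) e') e').
  move=> e'; have [/tame[s [rep _ _]]|_] := boolP (e' \in inc_edges (inl i : node N) :\ e).
    by exists s.
  by exists [::].
have [j [v [S [sS mE _ _]]]] := message_step t i e he tame smsg rep.
exists (emit (cap e)%:R ((1 - weight N) * cost e) j%:~R v S); rewrite /tame_message mE.
split; first exact: emit_represents.
  apply: convex_efun_add.
  - by move=> z; case: ifP; rewrite ?ltNyr.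
  - exact: pl_form_gtNoo.
  - exact: edge_fun_convex.
  - exact: pl_form_convex.
move=> z; have [/andP[/andP[_ zc] _] //|/clipped_oo ->] :=
  boolP ((0 <= z <= (cap e)%:R) && (j%:~R <= z <= j%:~R + (size S)%:R)).
by rewrite ltxx.
Qed.

End Messages.

Theorem proposition1 (R : realType) :
  (forall (N : network R), (exists x : edge N -> R, feasible_flow x) ->
    forall (i : 'I_(nsrc N)) (e : edge N) (t : nat),
      e \in inc_edges (inl i : node N) -> (0 < t)%N ->
      (forall z : R, 0 <= z -> exists y : \bar R,
         is_min (update_values i
           (fun e' => message t.-1 (other_end (inl i : node N) e') e') e z) y /\
         message t (inl i : node N) e z = (edge_fun e z + y)%E) /\
      pl_convex (message t (inl i : node N) e) (nat_upto (cap e)))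
  /\
  (exists (P : program) (C : nat),
    forall (N : network R), (exists x : edge N -> R, feasible_flow x) ->
    forall (i : 'I_(nsrc N)) (e : edge N) (t : nat),
      e \in inc_edges (inl i : node N) -> (0 < t)%N ->
    forall (sload : seq (piece R)) (smsg : edge N -> seq (piece R)),
      represents sload [set x | x \is a Num.int] (extend_nneg (load i)) ->
      (forall e', e' \in inc_edges (inl i : node N) :\ e ->
         represents (smsg e') (nat_upto (cap e'))
           (message t.-1 (other_end (inl i : node N) e') e')) ->
      exists (s : seq (piece R)) (k : nat),
        [/\ computes P (update_input i e sload smsg) (enc_pl s) k,
            represents s (nat_upto (cap e)) (message t (inl i : node N) e)
          & (k <= C * total_cap (inl i : node N) *
                 (1 + trunc_log 2 #|in_edges (inl i : node N)|
                    + trunc_log 2 #|out_edges (inl i : node N)|))%N]).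
Proof.
have tame (N : network R) (x : edge N -> R) (feas : feasible_flow x) t i (e : edge N) e' :
    e' \in inc_edges (inl i : node N) :\ e ->
    tame_message N t (other_end (inl i : node N) e') e'.
  rewrite inE => /andP[_ he']; apply: (message_tame N x feas); exact: other_end_inc.
split.
  move=> N [x feas] i e [//|t] he _.
  have [s [rep cv _]] := message_tame N x feas t.+1 (inl i) e he.
  split; last exact: represents_pl_convex rep cv.
  have /choice[smsg smsgP] : forall e', exists s, e' \in inc_edges (inl i : node N) :\ e ->
      represents s (nat_upto (cap e')) (message t (other_end (inl i : node N) e') e').
    move=> e'; have [/(tame N x feas t)[s' [rep' _ _]]|_] :=
      boolP (e' \in inc_edges (inl i : node N) :\ e).
      by exists s'.
    by exists [::].
  by have [j [v [S []]]] := message_step N x feas t i e he (tame N x feas t i e) smsg smsgP.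
exists min_sum_program, (200 * 130)%N => N [x feas] i e [//|t] he _ sload smsg repl repm.
have [j [v [S [_ mE _ run]]]] :=
  message_step N x feas t i e he (tame N x feas t i e) smsg repm.
have [k ck kn] := run sload repl.
exists (emit (cap e)%:R ((1 - weight N) * cost e) j%:~R v S), k; split=> //.
rewrite mE; exact: emit_represents.
Qed.
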